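(* Let $(Z_t)_{t\ge0}$ (with probability measures $\mathbb P^{(s,x)}$) be a branching process on $[0,\infty]$ whose Laplace exponents $(v_{s,t})_{(s,t)\in\Delta}$ form an absolutely continuous reverse evolution family in $\mathbb H$, and let $\phi(\zeta,t)=-q_t+a_t\zeta+b_t\zeta^2+\int_0^\infty(e^{-\zeta x}-1+\zeta x\mathbf 1_{(0,1)}(x))\pi_t(\mathrm dx)$ be its associated Herglotz vector field, with Lévy family $(q_t,a_t,b_t,\pi_t)_{t\ge0}$. The following are equivalent: (1) $\mathbb E^{(s,x)}[Z_t]<\infty$ for all $x\in(0,\infty)$ and $(s,t)\in\Delta$; (2) $\mathbb E^{(0,1)}[Z_t]<\infty$ for all $t\ge0$; (3) $v_{0,t}(0)=0$ and $v_{0,t}'(0)<\infty$ for all $t\ge0$; (4) $v_{s,t}(0)=0$ and $v_{s,t}'(0)<\infty$ for all $(s,t)\in\Delta$; (5) $\phi(0,t)=0$ for a.e. $t\ge0$ and $t\mapsto\phi'(0,t)$ is in $L^1_{\rm loc}$; (6) $q_t=0$ for a.e. $t\ge0$ and $t\mapsto\int_{[1,\infty)}x\,\pi_t(\mathrm dx)$ is in $L^1_{\rm loc}$. If these hold, then $\mathbb E^{(s,x)}[Z_t]=x\,v_{s,t}'(0)=x\exp\!\big(-\int_s^t\phi'(0,r)\,\mathrm dr\big)$ for all $x\in(0,\infty)$ and $(s,t)\in\Delta$.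
   Context: $\Delta=\{(s,t):0\le s\le t\}$, $\mathbb H=\{\operatorname{Re}\zeta>0\}$. A branching process on $[0,\infty]$ is a Markov family $(Z_t)$ (process with filtration $\mathcal F_I$ and probability measures $\mathbb P^{(s,x)}$ with $\mathbb P^{(s,x)}[Z_s=x]=1$ and the Markov property $\mathbb E^{(s,x)}[f(Z_u)|\mathcal F_{[s,t]}]=\int f(y)k_{t,u}(Z_t,\mathrm dy)$) whose transition kernels $(k_{s,t})$ on $[0,\infty]$ satisfy $k_{s,s}(x,\cdot)=\delta_x$, Chapman–Kolmogorov $k_{s,t}\star k_{t,u}=k_{s,u}$, weak continuity of $(s,t,x)\mapsto k_{s,t}(x,\cdot)$ on $\Delta\times[0,\infty)$, the branching property $k_{s,t}(x,\cdot)\ast k_{s,t}(y,\cdot)=k_{s,t}(x+y,\cdot)$, $k_{s,t}(0,\cdot)=\delta_0$, $k_{s,t}(\infty,\cdot)=\delta_\infty$. Its Laplace exponents are the Bernstein functions $v_{s,t}$ with $\int_{[0,\infty)}e^{-\theta y}k_{s,t}(x,\mathrm dy)=e^{-xv_{s,t}(\theta)}$, extended holomorphically to $\mathbb H$. Absolutely continuous reverse evolution family: $v_{s,s}={\rm id}$, $v_{s,u}=v_{s,t}\circ v_{t,u}$, and $|v_{s,u}(z)-v_{s,t}(z)|\le\int_t^u f_z$ for some nonnegative $f_z\in L^1_{\rm loc}$. Its associated Herglotz vector field is the (a.e.-unique) $\phi$ such that $s\mapsto v_{s,t}(\zeta)$ solves $\frac{\mathrm d}{\mathrm ds}v(s)=\phi(v(s),s)$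 a.e. on $[0,t]$, $v(t)=\zeta$; such $\phi$ has the stated form with a Lévy family ($a_t\in\mathbb R$, $q_t,b_t\ge0$, $\pi_t$ measures on $(0,\infty)$ with $\int\min\{1,x^2\}\pi_t<\infty$, integrability conditions in $t$). Notation: $v_{s,t}(0)=\lim_{\theta\to0^+}v_{s,t}(\theta)$, $v'_{s,t}(0)=\lim_{\theta\to0^+}v'_{s,t}(\theta)$, $\phi(0,t)=\lim_{\theta\to0^+}\phi(\theta,t)\in(-\infty,\infty]$, $\phi'(0,t)=\lim_{\theta\to0^+}\phi'(\theta,t)\in[-\infty,\infty)$, derivatives being in the spatial variable. *)

(* Defs.v *)
From mathcomp Require Import all_boot all_order all_algebra.
From mathcomp Require Import all_classical all_reals all_analysis measurable_realfun.
Import Order.TTheory GRing.Theory Num.Theory numFieldNormedType.Exports.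

Set Implicit Arguments.
Unset Strict Implicit.
Unset Printing Implicit Defensive.

Local Open Scope classical_set_scope.
Local Open Scope ring_scope.

Section BranchingDefs.
Context {R : realType}.
Local Notation leb := (@lebesgue_measure R).

Definition Sp : set (\bar R) := [set y | (0 <= y)%E].

Definition econv (mu nu : probability (\bar R) R) (A : set (\bar R)) : \bar R :=
  (\int[mu]_a \int[nu]_b ((\1_A (a + b) : R)%:E))%E.

Definition branching_kernels (k : R -> R -> \bar R -> probability (\bar R) R) : Prop :=
      (forall s t x, 0 <= s <= t -> Sp x -> k s t x Sp = 1%E) /\
      (forall s t A, 0 <= s <= t -> measurable A ->
         measurable_fun Sp (fun x => k s t x A)) /\
      (forall s x A, 0 <= s -> Sp x -> measurable A -> k s s x A = dirac x A) /\
      (forall s t u x A, 0 <= s <= t -> t <= u -> Sp x -> measurable A ->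
         k s u x A = (\int[k s t x]_y k t u y A)%E) /\
      (forall f : \bar R -> R, (forall y, f z @[z --> y] --> f y) ->
         {within [set p : R * R * R | 0 <= p.1.1 <= p.1.2 /\ 0 <= p.2],
           continuous (fun p : R * R * R =>
             fine (\int[k p.1.1 p.1.2 (p.2)%:E]_y (f y)%:E)%E)}) /\
      (forall s t x y A, 0 <= s <= t -> Sp x -> Sp y -> measurable A ->
         econv (k s t x) (k s t y) A = k s t (x + y)%E A) /\
      (forall s t A, 0 <= s <= t -> measurable A ->
         k s t 0%E A = dirac 0%E A /\ k s t +oo%E A = dirac +oo%E A).

(** A branching process on [0, +oo]: a Markov family (Z, F, P) with transition
    kernels k.  F s t is the sigma-algebra F_{[s,t]}, P s x is P^{(s,x)}. *)
Definition branching_process d (Omega : measurableType d)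
  (F : R -> R -> set (set Omega)) (P : R -> \bar R -> probability Omega R)
  (Z : R -> Omega -> \bar R) (k : R -> R -> \bar R -> probability (\bar R) R) : Prop :=
  branching_kernels k /\
      (forall t w, 0 <= t -> Sp (Z t w)) /\
      (forall s t, 0 <= s <= t -> sigma_algebra setT (F s t) /\ F s t `<=` measurable) /\
      (forall s s' t t', 0 <= s' <= s -> s <= t <= t' -> F s t `<=` F s' t') /\
      (forall s r t B, 0 <= s <= r -> r <= t -> measurable B -> F s t (Z r @^-1` B)) /\
      (forall s x, 0 <= s -> Sp x -> P s x [set w | Z s w = x] = 1%E) /\
      (* Markov property: E^{(s,x)}[f(Z_u) | F_{[s,t]}] = int f(y) k_{t,u}(Z_t, dy),
         stated through the defining property of conditional expectation,
         for nonnegative measurable f *)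
      (forall s t u x (f : \bar R -> \bar R), 0 <= s <= t -> t <= u -> Sp x ->
         measurable_fun setT f -> (forall y, (0 <= f y)%E) ->
         forall A, F s t A ->
           (\int[P s x]_(w in A) f (Z u w)
            = \int[P s x]_(w in A) \int[k t u (Z t w)]_y f y)%E).

Definition laplace_exponents (k : R -> R -> \bar R -> probability (\bar R) R)
  (v : R -> R -> R -> R) : Prop :=
  forall s t x theta, 0 <= s <= t -> 0 <= x -> 0 < theta ->
    (\int[k s t x%:E]_(y in [set y : \bar R | 0 <= y < +oo])
        (expR (- theta * fine y)%R)%:E
     = (expR (- x * v s t theta))%:E)%E.

(** Absolutely continuous reverse evolution family (tested on (0,+oo) = H cap R). *)
Definition ac_reverse_evolution_family (v : R -> R -> R -> R) : Prop :=
  [/\ (forall s t z, 0 <= s <= t -> 0 < z -> 0 < v s t z),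
      (forall s z, 0 <= s -> 0 < z -> v s s z = z),
      (forall s t u z, 0 <= s <= t -> t <= u -> 0 < z -> v s u z = v s t (v t u z)) &
      (forall z, 0 < z -> exists f : R -> R,
         [/\ (forall r, 0 <= f r),
             (forall T, 0 <= T -> leb.-integrable `[0, T] (fun r => (f r)%:E)) &
             (forall s t u, 0 <= s <= t -> t <= u ->
                `|v s u z - v s t z| <= fine (\int[leb]_(r in `[t, u]) (f r)%:E)%E)])].

Definition levy_family (q a b : R -> R) (pi : R -> {measure set R -> \bar R}) : Prop :=
  [/\ (forall t, 0 <= t -> 0 <= q t /\ 0 <= b t),
      (forall t, 0 <= t -> pi t [set x : R | x <= 0] = 0%E),
      (forall t, 0 <= t -> (\int[pi t]_x (Num.min 1 (x ^+ 2)%R)%:E < +oo)%E) &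
      (forall T, 0 <= T ->
         [/\ leb.-integrable `[0, T] (fun t => (q t)%:E),
             leb.-integrable `[0, T] (fun t => (a t)%:E),
             leb.-integrable `[0, T] (fun t => (b t)%:E) &
             leb.-integrable `[0, T] (fun t => \int[pi t]_x (Num.min 1 (x ^+ 2)%R)%:E)%E])].

Definition herglotz (q a b : R -> R) (pi : R -> {measure set R -> \bar R})
  (z t : R) : R :=
  - q t + a t * z + b t * z ^+ 2
  + fine (\int[pi t]_(x in [set x : R | (0 < x)%R])
            (expR (- z * x) - 1 + z * x * (\1_(`]0, 1[ : set R) x : R))%R%:E)%E.

(** phi is the Herglotz vector field associated with v: for each t >= 0 and
    zeta, s |-> v_{s,t}(zeta) is a (Caratheodory) solution on [0,t] of
    dv/ds = phi(v(s), s), v(t) = zeta. *)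
Definition associated_herglotz (v : R -> R -> R -> R) (phi : R -> R -> R) : Prop :=
  forall t z, 0 <= t -> 0 < z ->
    leb.-integrable `[0, t] (fun r => (phi (v r t z) r)%:E) /\
    (forall s, 0 <= s <= t ->
       v s t z = z - fine (\int[leb]_(r in `[s, t]) (phi (v r t z) r)%:E)%E).

Definition at0 (f : R -> R) : \bar R := lim ((f x)%:E @[x --> 0^'+]).
Definition dat0 (f : R -> R) : \bar R := at0 (derive1 f).

End BranchingDefs.

(* Main.v *)
Require Import Defs.
From mathcomp Require Import all_boot all_order all_algebra.
From mathcomp Require Import all_classical all_reals all_analysis measurable_realfun.
From mathcomp Require Import ring lra.
Import Order.TTheory GRing.Theory Num.Theory numFieldNormedType.Exports.
Local Open Scope classical_set_scope.
Local Open Scope ring_scope.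

Set Implicit Arguments.
Unset Strict Implicit.
Unset Printing Implicit Defensive.

(* Under P^{(s,x)} the variable Z_t has law k_{s,t}(x,.), whose Laplace transform
   is exp (- x v_{s,t}); expanding at the origin, the mean is finite exactly when
   v_{s,t}(0) = 0 and v'_{s,t}(0) < oo, and then equals x v'_{s,t}(0).

   The function phi(.,r) is convex with phi(0,r) = - q_r <= 0, so phi(z,r) / z
   decreases, as z decreases to 0, to phi'(0,r) if q_r = 0 and to -oo otherwise.
   Dividing the evolution equation by v gives
     v_{s,t}(z) / z = exp (- int_s^t phi(v_{r,t}(z),r) / v_{r,t}(z) dr),
   and v_{r,t}(z) decreases to 0 with z.  If the left-hand side stays bounded,
   monotone convergence forces q = 0 a.e. and phi'(0,.) integrable; conversely
   phi(z,r) >= z phi'(0,r) bounds the left-hand side, and dominated convergence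
   identifies its limit.  Finally phi'(0,r) = a_r - int_[1,oo) x pi_r(dx). *)

(** Condition (3) concerns the initial time 0 only, so (4) is reached through (5), since the vector
    field governs all initial times at once. The monotone convergence in (3) => (5) needs v_{r,t}(z)
    -> 0 at intermediate times r as well; this comes from v_{0,t} = v_{0,r} o v_{r,t}, because
    v_{0,r} is positive and nondecreasing. Two obstacles shape the rest. First, r |-> v_{r,t}(z) is
    only an indefinite integral, so dividing by v is a chain rule for [ln], obtained here from
    increments rather than pointwise derivatives. Second, integrability of phi in time is given
    along trajectories only, so even the measurability of phi'(0,.) has to be extracted from a limit
    along trajectories. Finally, [dat0] is a limit of derivatives while the evolution equation
    produces limits of quotients. The two are matched by computing both with monotone convergence,
    once for Laplace exponents (common value: the mean) and once for phi (common value: a minus the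
    first moment of the large jumps). *)

Section Elementary.
Context {R : realType}.
Implicit Types x y z w : R.

(** Since [expR x] is at least 1 + x, it suffices that (1 - x + x^2)(1 + x) = 1 + x^3 >= 1. *)
Lemma expRN_le_quad x : 0 <= x -> expR (- x) <= 1 - x + x ^+ 2.
Proof.
move=> x0; rewrite expRN -div1r ler_pdivrMr ?expR_gt0 //.
have p0 : 0 <= 1 - x + x ^+ 2 by have := sqr_ge0 (x - 1); nra.
have x3 : 0 <= x ^+ 3 by rewrite exprn_ge0.
have := ler_wpM2l p0 (expR_ge1Dx x); lra.
Qed.

Lemma expRN_ge1B x : 1 - x <= expR (- x).
Proof. exact: expR_ge1Dx. Qed.

(** This is the integral of e^{-zu} over u in [0,y]. For y >= 0 it increases to y as z decreases to
    0, so that integrals of it converge monotonically to first moments. *)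
Definition expquot z y : R := (1 - expR (- z * y)) / z.

Lemma expquot_ge0 z y : 0 < z -> 0 <= y -> 0 <= expquot z y.
Proof.
move=> z0 y0; rewrite divr_ge0 ?(ltW z0)// subr_ge0 -expR0 ler_expR.
by rewrite mulNr oppr_le0 mulr_ge0 // ltW.
Qed.

Lemma expquot_le z y : 0 < z -> expquot z y <= y.
Proof.
move=> z0; rewrite ler_pdivrMr // mulNr.
have := expRN_ge1B (z * y); lra.
Qed.

Lemma expquot_ge z y : 0 < z -> 0 <= y -> y - z * y ^+ 2 <= expquot z y.
Proof.
move=> z0 y0; rewrite ler_pdivlMr // mulNr.
have := expRN_le_quad (mulr_ge0 (ltW z0) y0); nra.
Qed.

Lemma expquot_anti z w y : 0 < z -> z <= w -> expquot w y <= expquot z y.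
Proof.
move=> z0 zw; have w0 : 0 < w := lt_le_trans z0 zw.
rewrite /expquot ler_pdivrMr // mulrAC ler_pdivlMr //.
have lam0 : 0 <= z / w by rewrite divr_ge0 // ltW.
have lam1 : z / w <= 1 by rewrite ler_pdivrMr // mul1r.
(* Convexity at the point -zy = (z/w)(-wy) + (1 - z/w) 0. *)
have := @convex_expR R (Itv01 lam0 lam1) (- w * y) 0.
rewrite !convRE/= expR0 mulr0 addr0 mulr1 mulrA mulrN divfK ?gt_eqF // => H.
have : w * expR (- z * y) <= z * expR (- w * y) + w - z.
  have -> : z * expR (- w * y) + w - z =
    w * (z / w * expR (- w * y) + (1 - z / w)) by field; rewrite gt_eqF.
  by rewrite ler_pM2l.
lra.
Qed.

Lemma cvg_expquot y : 0 <= y -> expquot z y @[z --> 0^'+] --> y.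
Proof.
move=> y0.
apply: (@squeeze_cvgr _ _ _ _ (fun z => y - z * y ^+ 2) (fun=> y)).
- near=> z; rewrite expquot_ge// ?expquot_le//.
- rewrite -[X in _ --> X](subr0 y); apply: cvgB; first exact: cvg_cst.
  rewrite -[X in _ --> X](mul0r (y ^+ 2)); apply: cvgMl.
  exact: cvg_at_right_filter.
- exact: cvg_cst.
Unshelve. all: by end_near. Qed.

Lemma mul_expRN_le x z : 0 < z -> 0 <= x -> x * expR (- z * x) <= z^-1.
Proof.
move=> z0 x0; rewrite -div1r ler_pdivlMr // mulNr expRN mulrAC.
rewrite ler_pdivrMr ?expR_gt0 // mul1r.
have := expR_ge1Dx (z * x); nra.
Qed.

Lemma cvg_expRN_at0 y : expR (- z * y) @[z --> 0^'+] --> (1 : R).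
Proof.
have H : - z * y @[z --> 0^'+] --> (- 0 * y : R).
  by apply: cvgMl; apply: cvgN; exact: cvg_at_right_filter.
rewrite oppr0 mul0r in H.
have := cvg_comp _ _ H (@continuous_expR R 0); by rewrite expR0.
Qed.

End Elementary.

(** * Monotone convergence as a real parameter decreases to 0 *)

Section AtRight.
Context {R : realType}.

Lemma harmonic_anti m n : (m <= n)%N -> harmonic n <= harmonic m :> R.
Proof. by move=> mn; rewrite lef_pV2 ?posrE// ler_nat. Qed.

Lemma cvg_harmonic_right : @harmonic R n @[n --> \oo] --> 0^'+.
Proof.
move=> A /= [e /= e0 eA].
have : @harmonic R n @[n --> \oo] --> (0:R) by exact: cvg_harmonic.
move=> /cvgrPdist_lt /(_ _ e0)[N _ HN]; exists N => // n Nn /=.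
by apply: eA; [exact: HN | exact: harmonic_gt0].
Qed.

Context d (T : measurableType d) (mu : {measure set T -> \bar R}).

(** Monotonicity in z already provides a limit at 0+; its value is read off along [harmonic], where
    sequential monotone convergence applies. *)
Lemma ge0_cvg_integral_at_right (D : set T) (F : R -> T -> R) (f : T -> R) :
  measurable D ->
  (forall z, 0 < z -> measurable_fun D (F z)) ->
  (forall z x, 0 < z -> D x -> 0 <= F z x) ->
  (forall z w x, 0 < z -> z <= w -> D x -> F w x <= F z x) ->
  (forall x, D x -> F z x @[z --> 0^'+] --> f x) ->
  (\int[mu]_(x in D) (F z x)%:E)%E @[z --> 0^'+] --> (\int[mu]_(x in D) (f x)%:E)%E.
Proof.
move=> mD mF F0 Fanti Ff.
pose I z := (\int[mu]_(x in D) (F z x)%:E)%E.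
have mono : {in Interval (BRight 0) (BInfty _ false) &, nonincreasing_fun I}.
  move=> z w; rewrite !in_itv/= !andbT => z0 w0 zw.
  apply: ge0_le_integral => //.
  - by move=> x Dx; rewrite lee_fin F0.
  - by apply/measurable_EFinP; exact: mF.
  - by apply/measurable_EFinP; exact: mF.
  - by move=> x Dx; rewrite lee_fin Fanti.
have cvgI := @nonincreasing_at_right_cvge R I 0 (BInfty _ false) isT mono.
suff -> : (\int[mu]_(x in D) (f x)%:E)%E = ereal_sup (I @` [set` `]0, +oo[]).
  exact: cvgI.
apply: (@cvg_unique _ _ ((I \o harmonic) @ \oo)).
- exact: ereal_hausdorff.
- have -> : (\int[mu]_(x in D) (f x)%:E)%E =
     (\int[mu]_(x in D) limn (fun n => (F (harmonic n) x)%:E))%E.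
    apply: eq_integral => x /set_mem Dx; symmetry; apply/cvg_lim => //.
    apply: cvg_EFin; first exact: nearW.
    exact: (cvg_comp _ _ cvg_harmonic_right (Ff _ Dx)).
  apply: cvg_monotone_convergence => //.
  + by move=> n; apply/measurable_EFinP; apply: mF; exact: harmonic_gt0.
  + by move=> n x Dx; rewrite lee_fin F0// harmonic_gt0.
  + by move=> x Dx m n mn; rewrite lee_fin Fanti// ?harmonic_gt0// harmonic_anti.
- exact: (cvg_comp _ _ cvg_harmonic_right cvgI).
Qed.

End AtRight.

(** * Laplace exponents at the origin *)

Section Deriv.
Context {R : realType} d (T : measurableType d) (mu : {measure set T -> \bar R}).

(** The parameters [c] and [A] let one statement serve twice: c = 0 and A = 0 for Laplace
    transforms, c = -1 and A(x) = x on (0,1), 0 elsewhere, for Levy-Khintchine integrals. *)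
Lemma is_derive_integral_exp (D : set T) (Y A G : T -> R) (c z u w : R) :
  measurable D -> u < z < w ->
  (forall x, u < x < w ->
     mu.-integrable D (fun y => (expR (- x * Y y) + c + x * A y)%:E)) ->
  (forall y, 0 <= G y) -> mu.-integrable D (EFin \o G) ->
  (forall x y, u < x < w -> D y -> `|A y - Y y * expR (- x * Y y)| <= G y) ->
  is_derive z 1 (fun x => \int[mu]_(y in D) (expR (- x * Y y) + c + x * A y))
    (\int[mu]_(y in D) (A y - Y y * expR (- z * Y y))).
Proof.
move=> mD zuw intf G0 intG Gub.
pose f x y := expR (- x * Y y) + c + x * A y.
have df (x : R) y : is_derive x 1 (f ^~ y) (A y - Y y * expR (- x * Y y)).
  rewrite /f; apply: is_derive_eq.
  rewrite /GRing.scale/=; ring.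
have d1f x y : partial1of2 f x y = A y - Y y * expR (- x * Y y).
  by rewrite partial1of2E; apply: derive_val.
have Iz : `]u, w[%classic z by rewrite /= in_itv.
have h1 x : `]u, w[%classic x -> mu.-integrable D (EFin \o f x).
  by rewrite /= in_itv/= => /intf.
have h2 x y : `]u, w[%classic x -> D y -> derivable (f ^~ y) x 1.
  by move=> _ _; apply: ex_derive.
have h3 x y : `]u, w[%classic x -> D y -> `|partial1of2 f x y| <= G y.
  by rewrite /= in_itv/= => uxw Dy; rewrite d1f Gub.
apply: DeriveDef.
  exact: (derivable_under_integral mD Iz h1 h2 G0 intG h3).
rewrite -derive1E (differentiation_under_integral mD Iz h1 h2 G0 intG h3).
by apply: eq_Rintegral => y _; rewrite d1f.
Qed.

End Deriv.

Section Laplace.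
Context {R : realType}.

(** The domain of integration in [laplace_exponents]. For a law on [0, +oo], the mass missing from
    it is the atom at +oo, which the Laplace transform does not see. *)
Definition fpos : set (\bar R) := [set y : \bar R | (0 <= y < +oo)%E].

Lemma measurable_fpos : measurable fpos.
Proof.
rewrite (_ : fpos = [set` `[0%E, +oo%E[]); first exact: emeasurable_itv.
by apply/seteqP; split => y /=; rewrite in_itv.
Qed.

Lemma measurable_fun_fine_fpos : measurable_fun fpos (@fine R).
Proof. exact/fine_measurable/measurable_fpos. Qed.

Lemma fine_fpos_ge0 y : fpos y -> 0 <= fine y.
Proof. by move=> /andP[y0 _]; exact: fine_ge0. Qed.

Hint Resolve measurable_fpos measurable_fun_fine_fpos : core.

Lemma measurable_expR_fine (z : R) :
  measurable_fun fpos (fun y : \bar R => expR (- z * fine y)).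
Proof.
apply: measurableT_comp => //; apply: measurable_funM => //.
Qed.
Hint Resolve measurable_expR_fine : core.

Implicit Types z w : R.
Variables (mu : probability (\bar R) R) (u : R -> R).
Hypothesis mu1 : mu Sp = 1%E.
Hypothesis muE : forall z, 0 < z ->
  (\int[mu]_(y in fpos) (expR (- z * fine y)%R)%:E = (expR (- u z))%:E)%E.

Let L z := \int[mu]_(y in fpos) expR (- z * fine y).
Let K z := \int[mu]_(y in fpos) (fine y * expR (- z * fine y)).
Let M0 := (\int[mu]_(y in fpos) (fine y)%:E)%E.

Let LE z : 0 < z -> L z = expR (- u z).
Proof. by move=> z0; rewrite /L /Rintegral muE. Qed.

Let mu_le1 : (mu fpos <= 1)%E.
Proof. exact: probability_le1. Qed.

Let mu_fin : (mu fpos < +oo)%E.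
Proof. by rewrite (le_lt_trans mu_le1)// ltry. Qed.

Let integrable_bounded (f : \bar R -> R) (c : R) : measurable_fun fpos f ->
  (forall y, fpos y -> `|f y| <= c) -> mu.-integrable fpos (EFin \o f).
Proof.
move=> mf fc; apply: measurable_bounded_integrable => //.
exists c; split; first by rewrite num_real.
by move=> x cx y Dy /=; rewrite (le_trans (fc _ Dy))// ltW.
Qed.

Let exp_le1 z y : 0 < z -> fpos y -> expR (- z * fine y) <= 1.
Proof.
move=> z0 Dy; rewrite -expR0 ler_expR mulNr oppr_le0 mulr_ge0 ?(ltW z0)//.
exact: fine_fpos_ge0.
Qed.

Let integrable_exp z : 0 < z ->
  mu.-integrable fpos (EFin \o (fun y => expR (- z * fine y))).
Proof.
move=> z0; apply: (@integrable_bounded _ 1) => // y Dy.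
by rewrite ger0_norm ?expR_ge0// exp_le1.
Qed.

Let integrable_Yexp z : 0 < z ->
  mu.-integrable fpos (EFin \o (fun y => fine y * expR (- z * fine y))).
Proof.
move=> z0; apply: (@integrable_bounded _ z^-1) => [|y Dy].
  exact: measurable_funM.
have y0 := fine_fpos_ge0 Dy.
by rewrite ger0_norm ?mulr_ge0 ?expR_ge0// mul_expRN_le.
Qed.

Lemma laplace_exponent_homo z w : 0 < z -> z <= w -> u z <= u w.
Proof.
move=> z0 zw; have w0 := lt_le_trans z0 zw.
rewrite -lerN2 -ler_expR -!LE //; apply: le_Rintegral => //.
- exact: integrable_exp.
- exact: integrable_exp.
- move=> y Dy; rewrite ler_expR !mulNr lerN2 ler_wpM2r//.
  exact: fine_fpos_ge0.
Qed.

Let is_derive_L z : 0 < z -> is_derive z 1 L (- K z).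
Proof.
move=> z0.
have z20 : 0 < z / 2 by rewrite divr_gt0.
(* On the window ]z/2, z+1[ one has y e^{-xy} <= 1/x <= (z/2)^{-1}, a constant and so integrable. *)
have H := @is_derive_integral_exp R _ _ mu fpos fine (cst 0)
  (cst (z / 2)^-1) 0 z (z / 2) (z + 1).
have E : (fun x => \int[mu]_(y in fpos) (expR (- x * fine y) + 0 + x * cst 0 y)) = L.
  by apply/funext => x; apply: eq_Rintegral => y _; rewrite /= mulr0 !addr0.
rewrite E in H; apply: is_derive_eq.
  apply: H => //.
  - by apply/andP; split; lra.
  - move=> x /andP[zx _]; have x0 : 0 < x by lra.
    apply: eq_integrable (integrable_exp x0) => // y _ /=.
    by rewrite mulr0 !addr0.
  - by move=> y /=; rewrite invr_ge0 ltW.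
  - apply: (@integrable_bounded _ (z/2)^-1) => //.
    by move=> y _ /=; rewrite ger0_norm// invr_ge0 ltW.
  - move=> x y /andP[zx _] Dy; have x0 : 0 < x by lra.
    have y0 := fine_fpos_ge0 Dy.
    rewrite /= sub0r normrN ger0_norm ?mulr_ge0 ?expR_ge0//.
    rewrite (le_trans (mul_expRN_le x0 y0))// lef_pV2 ?posrE//.
    exact: ltW.
rewrite /K -[RHS]mulN1r -RintegralZl//; last exact: integrable_Yexp.
by apply: eq_Rintegral => y _; rewrite /= sub0r mulN1r.
Qed.

Let L_gt0 z : 0 < z -> 0 < L z.
Proof. by move=> z0; rewrite LE // expR_gt0. Qed.

Lemma is_derive_laplace_exponent z : 0 < z -> is_derive z 1 u (K z / L z).
Proof.
move=> z0; apply: (@near_eq_is_derive _ _ _ (fun x => - ln (L x))).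
  near=> x; rewrite LE ?expRK ?opprK//; near: x.
  exact: lt_nbhsr.
have dL := is_derive_L z0; have dln := is_derive1_ln (L_gt0 z0).
have d1 := is_derive1_comp dln dL.
have d2 := is_deriveN d1.
apply: (is_derive_eq d2).
by rewrite /GRing.scale/=; field; rewrite gt_eqF ?L_gt0.
Unshelve. all: by end_near. Qed.

Let p := fine (mu fpos).

Let cvgL : L z @[z --> 0^'+] --> p.
Proof.
have H := @ge0_cvg_integral_at_right R _ _ mu fpos
  (fun z y => expR (- z * fine y)) (cst 1) measurable_fpos.
have H' : (\int[mu]_(y in fpos) (expR (- z * fine y))%:E)%E @[z --> 0^'+]
   --> (p%:E)%E.
  rewrite /p fineK ?ge0_fin_numE// -[X in _ --> X]mul1e.
  rewrite -(integral_cst mu measurable_fpos 1%E).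
  apply: H => //.
  - move=> z w y z0 zw Dy; rewrite ler_expR !mulNr lerN2 ler_wpM2r//.
    exact: fine_fpos_ge0.
  - by move=> y _; exact: cvg_expRN_at0.
exact: fine_cvg H'.
Qed.

(** Some mass is finite because L(1) = exp(-u(1)) > 0. This excludes p = 0, where [ln] is 0 by
    convention and [- ln p = 0] would not give p = 1. *)
Let p_gt0 : 0 < p.
Proof.
have : L 1 <= p.
  apply: (cvgr_to_ge cvgL); near=> z.
  rewrite !LE// ler_expR lerN2 laplace_exponent_homo//.
  by near: z; apply: nbhs_right_le.
apply: lt_le_trans; exact: L_gt0.
Unshelve. all: by end_near. Qed.

Lemma cvg_laplace_exponent : u z @[z --> 0^'+] --> - ln p.
Proof.
have H : - ln (L z) @[z --> 0^'+] --> - ln p.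
  by apply: cvgN; apply: continuous_cvg cvgL; exact: continuous_ln.
apply: cvg_trans H; apply: near_eq_cvg; near=> z.
by rewrite LE ?expRK ?opprK.
Unshelve. all: by end_near. Qed.

(** The limit of u at 0 is -ln p with p the mass of [fpos], so it vanishes exactly when no mass is
    lost. *)
Lemma at0_laplace_exponent : at0 u = 0%E <-> mu fpos = 1%E.
Proof.
have -> : at0 u = (- ln p)%:E.
  apply/cvg_lim => //; apply: cvg_EFin; first exact: nearW.
  exact: cvg_laplace_exponent.
split=> [[] /eqP|pE].
  rewrite oppr_eq0 ln_eq0// => /eqP p1.
  by rewrite -[LHS]fineK ?ge0_fin_numE// -/p p1.
by rewrite /p pE/= ln1 oppr0.
Qed.

Section Honest.
Hypothesis mu_fpos : mu fpos = 1%E.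

Let p1 : p = 1. Proof. by rewrite /p mu_fpos. Qed.

Let cvgu : u z @[z --> 0^'+] --> (0 : R).
Proof. by have := cvg_laplace_exponent; rewrite p1 ln1 oppr0. Qed.

(** [M0] may be +oo; the limit of the product is still legitimate because 1 is finite and
    nonzero. *)
Let cvg_mul_to1 (f g : R -> R) : (f z)%:E @[z --> 0^'+] --> M0 ->
  g z @[z --> 0^'+] --> (1 : R) -> (f z * g z)%:E @[z --> 0^'+] --> M0.
Proof.
move=> fM g1; rewrite -[X in _ --> X]mule1.
have g1' : (g z)%:E @[z --> 0^'+] --> 1%E.
  by apply: cvg_EFin => //; exact: nearW.
by apply: (cvgeM _ fM g1'); case: M0 => [r| |] //=; rewrite mule_defE/= (negbTE (oner_neq0 _)) ?andbF.

Qed.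

(** One has u' = K / L, where K increases to [M0] by monotone convergence and L tends to 1. *)
Lemma dat0_laplace_exponent : dat0 u = M0.
Proof.
apply/cvg_lim => //.
have H : (K z)%:E @[z --> 0^'+] --> M0.
  have H := @ge0_cvg_integral_at_right R _ _ mu fpos
    (fun z y => fine y * expR (- z * fine y)) fine measurable_fpos.
  apply: cvg_trans; last first.
    apply: H.
    - by move=> z _; exact: measurable_funM.
    - move=> z y z0 Dy; rewrite mulr_ge0 ?expR_ge0//; exact: fine_fpos_ge0.
    - move=> z w y z0 zw Dy; have y0 := fine_fpos_ge0 Dy.
      by rewrite ler_wpM2l// ler_expR !mulNr lerN2 ler_wpM2r.
    - move=> y _; rewrite -[X in _ --> X]mulr1; apply: cvgMr.
      exact: cvg_expRN_at0.
  apply: near_eq_cvg; near=> z; rewrite /K /Rintegral fineK//.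
  by apply: integrable_fin_num => //; exact: integrable_Yexp.
apply: cvg_trans (cvg_mul_to1 (g := fun z => (L z)^-1) H _); last first.
  rewrite -[X in _ --> X]invr1; apply: cvgV; first exact: oner_neq0.
  by rewrite -p1.
apply: near_eq_cvg; near=> z; rewrite derive1E.
have z0 : 0 < z by [].
by have [_ ->] := is_derive_laplace_exponent z0.
Unshelve. all: by end_near. Qed.

(** (1 - L(z)) / z is the integral of [expquot z], which increases to [M0]. It is compared with u/z
    through 1 - e^{-u} <= u <= (1 - e^{-u}) e^u, where e^u tends to 1. *)
Lemma cvg_laplace_exponent_quot : (u z / z)%:E @[z --> 0^'+] --> M0.
Proof.
pose N z := (1 - expR (- u z)) / z.
have NM : (N z)%:E @[z --> 0^'+] --> M0.
  have H := @ge0_cvg_integral_at_right R _ _ mu fpos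
    (fun z y => expquot z (fine y)) fine measurable_fpos.
  apply: cvg_trans; last first.
    apply: H.
    - move=> z z0; apply: measurable_funM => //; exact: measurable_funB.
    - move=> z y z0 Dy; apply: expquot_ge0 => //; exact: fine_fpos_ge0.
    - move=> z w y z0 zw Dy; exact: expquot_anti.
    - move=> y Dy; apply: cvg_expquot; exact: fine_fpos_ge0.
  apply: near_eq_cvg; near=> z.
  have z0 : 0 < z by [].
  have i1 : mu.-integrable fpos (EFin \o cst 1).
    by apply: (@integrable_bounded _ 1) => // y _ /=; rewrite normr1.
  have i2 := integrable_exp z0.
  rewrite -[LHS]fineK; last first.
    apply: integrable_fin_num => //.
    apply: (@integrable_bounded _ (2 / z)).
      by apply: measurable_funM => //; exact: measurable_funB.
    move=> y Dy; rewrite ger0_norm; last first.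
      by apply: expquot_ge0 => //; exact: fine_fpos_ge0.
    rewrite ler_pM2r ?invr_gt0//; have := expR_ge0 (- z * fine y); lra.
  congr EFin; rewrite -/(Rintegral _ _ _) /expquot.
  rewrite RintegralZr//; last first.
    apply: (@integrable_bounded _ 2); first exact: measurable_funB.
    move=> y Dy; have := expR_ge0 (- z * fine y); have := exp_le1 z0 Dy.
    by move=> h1 h2; rewrite ger0_norm; lra.
  rewrite (@RintegralB _ _ _ mu fpos (cst 1))// Rintegral_cst// mul1r.
  by rewrite -/(L z) LE// -/p p1.
apply: (@squeeze_cvge _ _ _ _ (fun z => (N z)%:E) _ (fun z => (N z * expR (u z))%:E)).
- near=> z; have z0 : 0 < z by [].
  rewrite !lee_fin /N; apply/andP; split.
    rewrite ler_pM2r ?invr_gt0//; have := expRN_ge1B (u z); lra.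
  rewrite mulrAC ler_pM2r ?invr_gt0// mulrBl mul1r -expRD addNr expR0.
  have := expR_ge1Dx (u z); lra.
- exact: NM.
- apply: cvg_mul_to1 => //; rewrite -expR0.
  by apply: continuous_cvg cvgu; exact: continuous_expR.
Unshelve. all: by end_near. Qed.

(** The absolute value keeps the integrand nonnegative on all of [\bar R], so the null complement of
    [fpos] can be discarded. *)
Lemma mean_fpos : (\int[mu]_y `|y| = M0)%E.
Proof.
have mC := measurableC measurable_fpos.
have m0 : mu (~` fpos) = 0%E by rewrite probability_setC// mu_fpos subee.
rewrite (ge0_negligible_integral mC measurableT) //.
rewrite setTD setCK; apply: eq_integral => y /set_mem /andP[y0 yoo].
by rewrite gee0_abs// fineK// ge0_fin_numE.
Qed.

End Honest.

(** An integrable function is finite almost everywhere, so +oo is not an atom, and [Sp] consists of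
    [fpos] and +oo. *)
Lemma mean_lty_fpos : (\int[mu]_y `|y| < +oo)%E -> mu fpos = 1%E.
Proof.
move=> Moo.
have int : mu.-integrable setT (fun y => y).
  by apply/integrableP; split.
have [N [mN N0 sN]] := integrable_ae measurableT int.
have oo0 : mu [set +oo%E] = 0%E.
  apply: (subset_measure0 _ mN _ N0) => //.
  by move=> y -> ; apply: sN => /=; apply/not_implyP.
have E : @Sp R = fpos `|` [set +oo%E].
  apply/seteqP; split => y /=; rewrite /Sp /fpos/=.
    by case: y => [r| |]//= y0; [left; rewrite y0 ltry|right].
  by case=> [/andP[]|->].
rewrite -mu1 E measureU0//.
Qed.

Lemma mean_ltyP : (\int[mu]_y `|y| < +oo)%E <-> at0 u = 0%E /\ (dat0 u < +oo)%E.
Proof.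
split=> [Moo|[/at0_laplace_exponent m1 doo]].
  have m1 := mean_lty_fpos Moo.
  by split; [exact/at0_laplace_exponent | rewrite dat0_laplace_exponent// -mean_fpos].
by rewrite mean_fpos// -dat0_laplace_exponent.
Qed.

Lemma mean_at0 : at0 u = 0%E ->
  dat0 u = (\int[mu]_y `|y|)%E /\
  (u z / z)%:E @[z --> 0^'+] --> (\int[mu]_y `|y|)%E.
Proof.
move=> /at0_laplace_exponent m1; rewrite mean_fpos//.
by split; [exact: dat0_laplace_exponent | exact: cvg_laplace_exponent_quot].
Qed.

End Laplace.

(** * Levy-Khintchine functions at the origin *)

Section LevyKhintchine.
Context {R : realType}.
Implicit Types x y z w : R.
Variables (q a b : R) (nu : {measure set R -> \bar R}).
Hypothesis b0 : 0 <= b.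
Hypothesis nu_fin : (\int[nu]_x (Num.min 1 (x ^+ 2)%R)%:E < +oo)%E.

Let Dpos : set R := [set x | 0 < x].
Let S1 : set R := `]0, 1[.
Let S2 : set R := [set x | 1 <= x].
Let m1 x : R := Num.min 1 (x ^+ 2).

Let h z x := expR (- z * x) - 1 + z * x * (\1_(`]0, 1[ : set R) x : R).

(** This is [herglotz] at a frozen time, convertible to it, so the results below transfer to the
    vector field without rewriting. *)
Definition levy_khintchine z : R :=
  - q + a * z + b * z ^+ 2
  + fine (\int[nu]_(x in [set x : R | (0 < x)%R]) (h z x)%:E)%E.

Let mDpos : measurable Dpos.
Proof.
rewrite (_ : Dpos = `]0, +oo[%classic)//.
by apply/seteqP; split => x /=; rewrite in_itv/= ?andbT.
Qed.
Let mS1 : measurable S1. Proof. exact: measurable_itv. Qed.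
Let mS2 : measurable S2.
Proof.
rewrite (_ : S2 = `[1, +oo[%classic)//.
by apply/seteqP; split => x /=; rewrite in_itv/= ?andbT.
Qed.

Let DposE : Dpos = S1 `|` S2.
Proof.
apply/seteqP; split => x /=; rewrite /Dpos /S1 /S2 /= in_itv/=.
  by move=> x0; case: (ltP x 1) => x1; [left; rewrite x0|right].
by case=> [/andP[]//|]; apply: lt_le_trans.
Qed.

Let disS : [disjoint S1 & S2].
Proof.
apply/disj_setPS => x [/=]; rewrite /S1 /S2 /= in_itv/= => /andP[_ x1].
by rewrite leNgt x1.
Qed.

Let m1S1 x : S1 x -> m1 x = x ^+ 2.
Proof.
rewrite /S1 /= in_itv/= => /andP[x0 x1]; rewrite /m1; apply/min_idPr.
by rewrite expr_le1// ltW.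
Qed.

Let m1S2 x : S2 x -> m1 x = 1.
Proof.
rewrite /S2/= => x1; apply/min_idPl; rewrite exprn_ege1//.
Qed.

Let m1_ge0 x : 0 <= m1 x.
Proof. by rewrite /m1 le_min ler01 sqr_ge0. Qed.

Let mm1 : measurable_fun setT m1.
Proof. by apply: measurable_minr. Qed.

Let im1 (D : set R) : measurable D -> nu.-integrable D (EFin \o m1).
Proof.
move=> mD; apply: (@integrableS _ _ _ _ setT) => //.
apply/integrableP; split; first exact/measurable_EFinP.
apply: le_lt_trans nu_fin; rewrite le_eqVlt; apply/orP; left; apply/eqP.
by apply: eq_integral => x _ /=; rewrite ger0_norm.
Qed.

(** min(1, x^2) is the one function assumed [nu]-integrable; integrability below comes from
    domination by a multiple of it. *)
Let integrable_dom (D : set R) (f : R -> R) (c : R) : measurable D ->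
  measurable_fun D f -> (forall x, D x -> `|f x| <= c * m1 x) ->
  nu.-integrable D (EFin \o f).
Proof.
move=> mD mf fc.
have ig : nu.-integrable D (EFin \o (fun x => c * m1 x)).
  exact: (integrableZl mD c (im1 mD)).
apply: (le_integrable mD _ _ ig); first exact/measurable_EFinP.
by move=> x Dx /=; rewrite lee_fin (le_trans (fc _ Dx))// ler_norm.
Qed.

Let mexp (D : set R) z : measurable_fun D (fun x => expR (- z * x)).
Proof.
apply: measurable_funTS; apply: measurableT_comp => //.
Qed.

Let mexpquot (D : set R) z : measurable_fun D (expquot z).
Proof. by apply: measurable_funM => //; apply: measurable_funB. Qed.

Let mh (D : set R) z : measurable_fun D (h z).
Proof.
apply: measurable_funD; first exact: measurable_funB.
apply: measurable_funM; first exact: measurable_funM.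
by apply: measurable_funTS; exact: measurable_indic.
Qed.

Let S1_gt0 x : S1 x -> 0 <= x.
Proof. by rewrite /S1 /= in_itv/= => /andP[/ltW]. Qed.

Let S2_gt0 x : S2 x -> 0 <= x.
Proof. by rewrite /S2 /= => /(le_trans ler01). Qed.

Let indS1 x : S1 x -> \1_(`]0, 1[ : set R) x = 1 :> R.
Proof. by move=> Sx; rewrite indicE mem_set. Qed.

Let indS2 x : S2 x -> \1_(`]0, 1[ : set R) x = 0 :> R.
Proof.
move=> Sx; rewrite indicE memNset//= in_itv/= => /andP[_].
by rewrite ltNge Sx.
Qed.

Let exp_le1 z x : 0 < z -> 0 <= x -> expR (- z * x) <= 1.
Proof.
by move=> z0 x0; rewrite -expR0 ler_expR mulNr oppr_le0 mulr_ge0 // ltW.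
Qed.

Let integrable_gap z : 0 < z ->
  nu.-integrable S1 (EFin \o (fun x => x - expquot z x)).
Proof.
move=> z0; apply: (@integrable_dom _ _ z) => //; first exact: measurable_funB.
move=> x Sx; rewrite m1S1//; have x0 := S1_gt0 Sx.
rewrite ger0_norm ?subr_ge0 ?expquot_le//.
by have := expquot_ge z0 x0; lra.
Qed.

Let integrable_tail z : 0 < z ->
  nu.-integrable S2 (EFin \o (fun x => 1 - expR (- z * x))).
Proof.
move=> z0; apply: (@integrable_dom _ _ 1) => //; first exact: measurable_funB.
move=> x Sx; rewrite m1S2// mulr1; have x0 := S2_gt0 Sx.
rewrite ger0_norm ?subr_ge0 ?exp_le1//.

Qed.

Let integrable_tail_quot z : 0 < z -> nu.-integrable S2 (EFin \o expquot z).
Proof.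
move=> z0; have := integrableZl mS2 z^-1 (integrable_tail z0).
by apply: eq_integrable => // x _ /=; rewrite -EFinM mulrC.
Qed.

Let integrable_h z : 0 < z -> nu.-integrable Dpos (EFin \o h z).
Proof.
(* The integrand is at most z^2 x^2 on small jumps, by the quadratic bound on the exponential, and
   at most 1 in absolute value on large jumps. *)
move=> z0; apply: (@integrable_dom _ _ (z ^+ 2 + 1)) => //.
move=> x; rewrite DposE => -[Sx|Sx].
  have x0 := S1_gt0 Sx; rewrite m1S1// /h indS1// mulr1.
  have h1 := expRN_ge1B (z * x).
  have h2 := expRN_le_quad (mulr_ge0 (ltW z0) x0).
  have h3 := sqr_ge0 x.
  by rewrite mulNr ger0_norm; nra.
have x0 := S2_gt0 Sx; rewrite m1S2// /h indS2// mulr0 addr0 mulr1.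
have h1 := exp_le1 z0 x0; have h2 := expR_ge0 (- z * x).
rewrite ler0_norm; last lra.
have := sqr_ge0 z; lra.
Qed.

(** Compensated small jumps contribute z [gap z] and large jumps contribute -[tail z]; after
    division by z both are integrals monotone in z through [expquot]. *)
Let gap z := \int[nu]_(x in S1) (x - expquot z x).
Let tail z := \int[nu]_(x in S2) (1 - expR (- z * x)).

Let levyE z : 0 < z ->
  levy_khintchine z = - q + a * z + b * z ^+ 2 + z * gap z - tail z.
Proof.
move=> z0; rewrite /levy_khintchine -[RHS]addrA; congr (_ + _).
transitivity (\int[nu]_(x in Dpos) h z x) => //.
rewrite DposE Rintegral_setU//; last first.
  by rewrite -DposE; exact: integrable_h.
congr (_ + _).
  rewrite /gap -RintegralZl//; last exact: integrable_gap.
  apply: eq_Rintegral => x /set_mem Sx; rewrite /h indS1// /expquot.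
  by field; rewrite gt_eqF.
rewrite /tail -[RHS]mulN1r -RintegralZl//; last exact: integrable_tail.
apply: eq_Rintegral => x /set_mem Sx; rewrite /h indS2//; ring.
Qed.

Let tailE z : 0 < z -> tail z / z = \int[nu]_(x in S2) (expquot z x).
Proof.
by move=> z0; rewrite /tail -RintegralZr//; exact: integrable_tail.
Qed.

Let levy_quotE z : 0 < z ->
  (levy_khintchine z + q) / z =
  a + b * z + gap z - \int[nu]_(x in S2) (expquot z x).
Proof. by move=> z0; rewrite levyE// -tailE//; field; rewrite gt_eqF. Qed.

(** Adding q cancels the constant term. After division by z, the terms b z, [gap z] and minus the
    integral of [expquot z] over large jumps are each nondecreasing. *)
Lemma levy_khintchine_quot_homo z w : 0 < z -> z <= w ->
  (levy_khintchine z + q) / z <= (levy_khintchine w + q) / w.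
Proof.
move=> z0 zw; have w0 := lt_le_trans z0 zw; rewrite !levy_quotE//.
apply: lerB; [apply: lerD|].
- by rewrite lerD2l ler_wpM2l.
- apply: le_Rintegral => //; [exact: integrable_gap..|].
  by move=> x Sx; rewrite lerD2l lerN2 expquot_anti.
- apply: le_Rintegral => //; [exact: integrable_tail_quot..|].
  by move=> x Sx; exact: expquot_anti.
Qed.

Let C := \int[nu]_(x in S1) (x ^+ 2).

Let integrable_sqr : nu.-integrable S1 (EFin \o (fun x => x ^+ 2)).
Proof.
apply: eq_integrable (im1 mS1) => // x /set_mem Sx /=.
by rewrite m1S1.
Qed.

Let cvg_mulz (c : R) : z * c @[z --> 0^'+] --> (0 : R).
Proof.
have : z * c @[z --> 0^'+] --> (0 * c : R).
  by apply: cvgMl; exact: cvg_at_right_filter.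
by rewrite mul0r.
Qed.

Let cvg_small (f : R -> R -> R) :
  (forall z, 0 < z -> nu.-integrable S1 (EFin \o f z)) ->
  (forall z x, 0 < z -> S1 x -> 0 <= f z x <= z * x ^+ 2) ->
  \int[nu]_(x in S1) f z x @[z --> 0^'+] --> (0 : R).
Proof.
move=> If fb.
apply: (@squeeze_cvgr _ _ _ _ (fun=> 0) (fun z => z * C)).
- near=> z; have z0 : 0 < z by [].
  apply/andP; split.
    by apply: Rintegral_ge0 => x /(fb _ _ z0) /andP[].
  rewrite -RintegralZl//; apply: le_Rintegral => //; first exact: If.
    exact: (integrableZl mS1 z integrable_sqr).
  by move=> x /(fb _ _ z0) /andP[].
- exact: cvg_cst.
- exact: cvg_mulz.
Unshelve. all: by end_near. Qed.

Let cvg_gap : gap z @[z --> 0^'+] --> (0 : R).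
Proof.
apply: cvg_small; first exact: integrable_gap.
move=> z x z0 Sx; have x0 := S1_gt0 Sx.
rewrite subr_ge0 expquot_le//=; have := expquot_ge z0 x0; lra.
Qed.

Let cvg_tail : tail z @[z --> 0^'+] --> (0 : R).
Proof.
have i1 : nu.-integrable S2 (EFin \o cst 1).
  by apply: eq_integrable (im1 mS2) => // x /set_mem Sx /=; rewrite m1S2.
have ie z : 0 < z -> nu.-integrable S2 (EFin \o (fun x => expR (- z * x))).
  move=> z0; apply: (@integrable_dom _ _ 1) => // x Sx.
  by rewrite m1S2// mulr1 ger0_norm ?expR_ge0// exp_le1//; exact: S2_gt0.
have H : (\int[nu]_(x in S2) (expR (- z * x))%:E)%E @[z --> 0^'+] -->
    (\int[nu]_(x in S2) 1)%:E.
  rewrite /Rintegral fineK; last exact: integrable_fin_num i1.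
  apply: ge0_cvg_integral_at_right => //.
  - move=> z w x z0 zw Sx; rewrite ler_expR !mulNr lerN2 ler_wpM2r//.
    exact: S2_gt0.
  - by move=> x _; exact: cvg_expRN_at0.
have H2 : \int[nu]_(x in S2) 1 - \int[nu]_(x in S2) expR (- z * x)
    @[z --> 0^'+] --> (0 : R).
  rewrite -[X in _ --> X](subrr (\int[nu]_(x in S2) 1)).
  by apply: cvgB; [exact: cvg_cst | exact: fine_cvg H].
apply: cvg_trans H2; apply: near_eq_cvg; near=> z.
by rewrite /tail (@RintegralB _ _ _ nu S2 (cst 1))//; exact: ie.
Unshelve. all: by end_near. Qed.

Lemma at0_levy_khintchine : at0 levy_khintchine = (- q)%:E.
Proof.
apply/cvg_lim => //; apply: cvg_EFin; first exact: nearW.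
have H : - q + (z * a + z * (z * b)) + z * gap z - tail z @[z --> 0^'+] -->
    - q + (0 + 0 * 0) + 0 * 0 - 0.
  have cz : z @[z --> 0^'+] --> (0 : R) by exact: cvg_at_right_filter.
  apply: cvgB => //; apply: cvgD; [apply: cvgD; [exact: cvg_cst|]|].
    apply: cvgD; first exact: cvg_mulz.
    by apply: cvgM => //; exact: cvg_mulz.
  exact: cvgM.
rewrite !mul0r !addr0 subr0 in H.
apply: cvg_trans H; apply: near_eq_cvg; near=> z.
by rewrite /= levyE//; ring.
Unshelve. all: by end_near. Qed.

Let G := (\int[nu]_(x in S2) x%:E)%E.

Let cvgB_G (f g : R -> R) : f z @[z --> 0^'+] --> a ->
  (g z)%:E @[z --> 0^'+] --> G -> (f z - g z)%:E @[z --> 0^'+] --> (a%:E - G)%E.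
Proof.
move=> fa gG.
have fa' : (f z)%:E @[z --> 0^'+] --> a%:E.
  by apply: cvg_EFin => //; exact: nearW.
by apply: (cvgeB _ fa' gG); rewrite fin_num_adde_defr.
Qed.

(** The small-jump term is O(z) and the large-jump term increases to the moment [G]. The latter may
    be +oo, but a - G makes sense because a is finite. *)
Lemma cvg_levy_khintchine_quot :
  ((levy_khintchine z + q) / z)%:E @[z --> 0^'+] --> (a%:E - G)%E.
Proof.
have H1 : a + z * b + gap z @[z --> 0^'+] --> a.
  rewrite -[X in _ --> X]addr0; apply: cvgD => //.
  by rewrite -[X in _ --> X]addr0; apply: cvgD; [exact: cvg_cst|exact: cvg_mulz].
have H2 : (\int[nu]_(x in S2) expquot z x)%:E @[z --> 0^'+] --> G.
  have H : (\int[nu]_(x in S2) (expquot z x)%:E)%E @[z --> 0^'+] --> G.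
    apply: ge0_cvg_integral_at_right => //.
    - by move=> z x z0 Sx; apply: expquot_ge0 => //; exact: S2_gt0.
    - by move=> z w x z0 zw _; exact: expquot_anti.
    - by move=> x Sx; apply: cvg_expquot; exact: S2_gt0.
  apply: cvg_trans H; apply: near_eq_cvg; near=> z.
  rewrite /Rintegral fineK//; apply: integrable_fin_num => //.
  exact: integrable_tail_quot.
apply: cvg_trans (cvgB_G H1 H2); apply: near_eq_cvg; near=> z.
by rewrite levy_quotE// (mulrC b).
Unshelve. all: by end_near. Qed.

Let A x := x * (\1_(`]0, 1[ : set R) x : R).

Let dom_deriv z x : 0 < z -> Dpos x ->
  `|A x - x * expR (- z * x)| <= (z + z^-1) * m1 x.
Proof.
move=> z0; have iz : 0 < z^-1 by rewrite invr_gt0.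
rewrite DposE => -[Sx|Sx].
  have x0 := S1_gt0 Sx; rewrite m1S1// /A indS1// mulr1.
  have h1 := exp_le1 z0 x0; have h2 := expRN_ge1B (z * x).
  rewrite -mulNr in h2; rewrite ger0_norm; last by nra.
  have : x - x * expR (- z * x) <= z * x ^+ 2 by nra.
  have := mulr_ge0 (ltW iz) (sqr_ge0 x); lra.
have x0 := S2_gt0 Sx; rewrite m1S2// /A indS2// mulr0 sub0r normrN mulr1.
rewrite ger0_norm ?mulr_ge0 ?expR_ge0//.
have := mul_expRN_le z0 x0; lra.
Qed.

Let mA (D : set R) : measurable_fun D A.
Proof.
by apply: measurable_funTS; apply: measurable_funM => //; exact: measurable_indic.
Qed.

Let mderiv (D : set R) z : measurable_fun D (fun x => A x - x * expR (- z * x)).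
Proof. by apply: measurable_funB => //; exact: measurable_funM. Qed.

Let integrable_deriv z : 0 < z ->
  nu.-integrable Dpos (EFin \o (fun x => A x - x * expR (- z * x))).
Proof.
move=> z0; apply: (@integrable_dom _ _ (z + z^-1)) => // x Dx.
exact: dom_deriv.
Qed.

Let J z := \int[nu]_(x in Dpos) (A x - x * expR (- z * x)).

Let is_derive_levy z : 0 < z ->
  is_derive z 1 levy_khintchine (a + b * z *+ 2 + J z).
Proof.
move=> z0; have z20 : 0 < z / 2 by rewrite divr_gt0.
(* Bounds x + x^{-1}, the factor in [dom_deriv], for all x in ]z/2, z+1[. *)
pose c := z + 1 + (z / 2)^-1.
have c0 : 0 <= c.
  have := invr_ge0 (z / 2); rewrite (ltW z20) /c => /idP; lra.
have dI : is_derive z 1 (fun x => \int[nu]_(y in Dpos) (expR (- x * y) + (-1) + x * A y)) (J z).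
  apply: (@is_derive_integral_exp R _ _ nu Dpos id A (fun x => c * m1 x)
    (-1) z (z / 2) (z + 1)) => //.
  - by apply/andP; split; lra.
  - move=> x /andP[zx _]; have x0 : 0 < x by lra.
    apply: eq_integrable (integrable_h x0) => // y _ /=.
    by rewrite /h /A mulrA.
  - by move=> y; rewrite mulr_ge0.
  - exact: (integrableZl mDpos c (im1 mDpos)).
  - move=> x y /andP[zx xz] Dy; have x0 : 0 < x by lra.
    rewrite (le_trans (dom_deriv x0 Dy))// ler_wpM2r// /c lerD ?(ltW xz)//.
    by rewrite lef_pV2 ?posrE// ltW.
rewrite (_ : (fun x => _) = (fun x => \int[nu]_(y in Dpos) h x y)) in dI; last first.
  by apply/funext => x; apply: eq_Rintegral => y _; rewrite /h /A mulrA.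
rewrite (_ : levy_khintchine =
  (fun z => - q + a * z + b * z ^+ 2) + (fun x => \int[nu]_(y in Dpos) h x y)) //.
have d0 : is_derive z 1 (fun z => - q + a * z + b * z ^+ 2) (a + b * z *+ 2).
  apply: is_derive_eq; rewrite /GRing.scale/=; ring.
exact: is_deriveD.
Qed.

(** The derivative is a + 2bz + g1 - g2, where g1 = O(z) comes from small jumps and g2 increases to
    [G]; hence the same limit as for the quotient. *)
Lemma dat0_levy_khintchine : dat0 levy_khintchine = (a%:E - G)%E.
Proof.
pose g1 z := \int[nu]_(x in S1) (x - x * expR (- z * x)).
pose g2 z := \int[nu]_(x in S2) (x * expR (- z * x)).
have i1 z : 0 < z -> nu.-integrable S1 (EFin \o (fun x => x - x * expR (- z * x))).
  move=> z0; have : nu.-integrable S1 (EFin \o (fun x => A x - x * expR (- z * x))).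
    apply: integrableS (integrable_deriv z0) => //.
    by rewrite DposE; exact: subsetUl.
  by apply: eq_integrable => // x /set_mem Sx; rewrite /= /A indS1// mulr1.
have i2 z : 0 < z -> nu.-integrable S2 (EFin \o (fun x => x * expR (- z * x))).
  move=> z0; apply: (@integrable_dom _ _ z^-1) => //; first exact: measurable_funM.
  move=> x Sx; have x0 := S2_gt0 Sx.
  by rewrite m1S2// mulr1 ger0_norm ?mulr_ge0 ?expR_ge0// mul_expRN_le.
have JE z : 0 < z -> J z = g1 z - g2 z.
  move=> z0; rewrite /J DposE Rintegral_setU//; last first.
    by rewrite -DposE; exact: integrable_deriv.
  congr (_ + _).
    by apply: eq_Rintegral => x /set_mem Sx; rewrite /A indS1// mulr1.
  rewrite -[RHS]mulN1r -RintegralZl//; last exact: i2.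
  by apply: eq_Rintegral => x /set_mem Sx; rewrite /A indS2// mulr0 sub0r mulN1r.
have H1 : a + z * (b *+ 2) + g1 z @[z --> 0^'+] --> a.
  rewrite -[X in _ --> X]addr0; apply: cvgD.
    by rewrite -[X in _ --> X]addr0; apply: cvgD; [exact: cvg_cst|exact: cvg_mulz].
  apply: cvg_small => // z x z0 Sx; have x0 := S1_gt0 Sx.
  have h1 := exp_le1 z0 x0; have h2 := expRN_ge1B (z * x).
  rewrite -mulNr in h2; apply/andP; split; nra.
have H2 : (g2 z)%:E @[z --> 0^'+] --> G.
  have H : (\int[nu]_(x in S2) (x * expR (- z * x))%:E)%E @[z --> 0^'+] --> G.
    apply: ge0_cvg_integral_at_right => //.
    - by move=> z z0; exact: measurable_funM.
    - by move=> z x z0 Sx; rewrite mulr_ge0 ?expR_ge0//; exact: S2_gt0.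
    - move=> z w x z0 zw Sx; have x0 := S2_gt0 Sx.
      by rewrite ler_wpM2l// ler_expR !mulNr lerN2 ler_wpM2r.
    - move=> x _; rewrite -[X in _ --> X]mulr1; apply: cvgMr.
      exact: cvg_expRN_at0.
  apply: cvg_trans H; apply: near_eq_cvg; near=> z.
  rewrite /g2 /Rintegral fineK//; apply: integrable_fin_num => //.
  exact: i2.
apply/cvg_lim => //; apply: cvg_trans (cvgB_G H1 H2); apply: near_eq_cvg.
near=> z; have z0 : 0 < z by [].
rewrite derive1E; have [_ ->] := is_derive_levy z0.
by rewrite JE//; congr EFin; ring.
Unshelve. all: by end_near. Qed.

End LevyKhintchine.

(** * Logarithm of an indefinite integral *)

Section LogIntegral.
Context {R : realType}.
Local Notation leb := (@lebesgue_measure R).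
Implicit Types (x y s t : R) (f g V : R -> R).

(** Continuous induction: the supremum of the points x with f s <= f x has this property itself, and
    if it lay below t, local monotonicity around it would yield a larger such point. *)
Lemma locally_nondecreasing_le f s t : s <= t ->
  (forall c, s <= c <= t -> exists2 e, 0 < e &
     forall x y, s <= x -> x <= y -> y <= t ->
       `|x - c| < e -> `|y - c| < e -> f x <= f y) ->
  f s <= f t.
Proof.
move=> st loc; pose A := [set x | s <= x <= t /\ f s <= f x].
have As : A s by split; rewrite ?lexx ?st.
have ubA : ubound A t by move=> x [/andP[]].
have supA : has_sup A by split; [exists s | exists t].
have sS : s <= sup A by apply: ub_le_sup => //; exists t.
have St : sup A <= t by apply: ge_sup => //; exists s.
have [e e0 He] := loc (sup A) ltac:(by rewrite sS St).
have [x Ax xS] := sup_adherent e0 supA.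
have xS' : x <= sup A by apply: ub_le_sup => //; exists t.
have [/andP[sx xt] fx] := Ax.
have fS : f s <= f (sup A).
  apply: (le_trans fx); apply: He => //; last by rewrite subrr normr0.
  by rewrite ler0_norm; lra.
have [->//|nSt] := eqVneq t (sup A).
have {nSt}St : sup A < t by rewrite lt_neqAle eq_sym nSt.
pose y := Num.min t (sup A + e / 2).
have Sy : sup A < y by rewrite lt_min St ltrDl divr_gt0.
have ye : y <= sup A + e / 2 by rewrite ge_min lexx orbT.
have yt : y <= t by rewrite ge_min lexx.
have : A y.
  split; first by rewrite yt andbT (le_trans sS)// ltW.
  apply: (le_trans fS); apply: He => //; first exact: ltW.
    by rewrite subrr normr0.
  by rewrite ger0_norm; lra.
by move/(ub_le_sup (ex_intro _ _ ubA)); rewrite leNgt Sy.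
Qed.

(** Both sides are ln(1 + h) <= h, with x and y exchanged. The slopes 1/x and 1/y become endpoint
    values of 1/V, which [log_increment] controls. *)
Lemma ln_diff_bounds x y : 0 < x -> 0 < y ->
  (y - x) / y <= ln y - ln x <= (y - x) / x.
Proof.
have key (u w : R) : 0 < u -> 0 < w -> ln w - ln u <= (w - u) / u.
  move=> u0 w0; rewrite -ln_div ?posrE//.
  have -> : w / u = 1 + (w - u) / u by field; rewrite gt_eqF.
  apply: le_ln1Dx; rewrite ltr_pdivlMr//; lra.
move=> x0 y0; rewrite key// andbT.
have -> : (y - x) / y = - ((x - y) / y) by rewrite -mulNr opprB.
have := key y x y0 x0; lra.
Qed.

Lemma integrable_subitv (f : R -> \bar R) s t x y : s <= x -> y <= t ->
  leb.-integrable `[s, t] f -> leb.-integrable `[x, y] f.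
Proof.
move=> sx yt; apply: integrableS => //.
by apply: subset_itv; rewrite bnd_simp.
Qed.

Lemma Rintegral_itv_split f s t x y : s <= x -> x <= y -> y <= t ->
  leb.-integrable `[s, t] (EFin \o f) ->
  \int[leb]_(r in `[s, y]) f r - \int[leb]_(r in `[s, x]) f r =
  \int[leb]_(r in `[x, y]) f r.
Proof.
move=> sx xy yt intf.
have int' := integrable_subitv (lexx s) yt intf.
rewrite Rintegral_itvB ?bnd_simp// Rintegral_itv_obnd_cbnd//.
apply: integrableS int' => //.
by apply: subset_itv; rewrite bnd_simp.
Qed.

Variables (V g : R -> R) (s t : R).
Hypothesis st : s <= t.
Hypothesis intg : leb.-integrable `[s, t] (EFin \o g).
Hypothesis Vg : forall x y, s <= x -> x <= y -> y <= t ->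
  V y - V x = \int[leb]_(r in `[x, y]) g r.
Hypothesis V0 : forall x, s <= x <= t -> 0 < V x.

Lemma primitive_continuous : {within `[s, t], continuous V}.
Proof.
apply: (@subspace_eq_continuous _ _ _
  (fun x => V s + parameterized_integral leb s x g)).
  move=> x /set_mem; rewrite /= in_itv/= => /andP[sx xt].
  by rewrite /from_subspace /= /parameterized_integral -(Vg (lexx s) sx xt) addrC subrK.
apply/subspace_continuousP => x sxt; apply: cvgD; first exact: cvg_cst.
exact: (subspace_continuousP _ _).1 (parameterized_integral_continuous st intg) x sxt.
Qed.

Let cW : {within `[s, t], continuous (fun x => (V x)^-1)}.
Proof.
apply/subspace_continuousP => x sxt; apply: cvgV.
  by rewrite gt_eqF// V0//; move: sxt; rewrite /= in_itv.
exact: (subspace_continuousP _ _).1 primitive_continuous x sxt.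
Qed.

Lemma measurable_inv_primitive : measurable_fun `[s, t] (fun x => (V x)^-1).
Proof. by apply: subspace_continuous_measurable_fun => //; exact: cW. Qed.

(** V is continuous and positive on a compact interval, so 1/V has a maximum there and a multiple of
    |g| dominates. *)
Lemma integrable_quot_primitive :
  leb.-integrable `[s, t] (EFin \o (fun r => g r / V r)).
Proof.
have [c _ Hc] := EVT_max st cW.
have ig : leb.-integrable `[s, t] (fun r => (V c)^-1%:E * (`|g r|)%:E)%E.
  by apply: integrableZl => //; exact: (integrable_norm intg).
apply: (le_integrable _ _ _ ig) => //.
  apply/measurable_EFinP; apply: measurable_funM.
    by apply/measurable_EFinP; exact: measurable_int intg.
  exact: measurable_inv_primitive.
move=> r /= rst; have rst' : s <= r <= t by move: rst; rewrite in_itv.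
have Vr := V0 rst'; have Vc := Hc _ rst.
have Vr' : 0 < (V r)^-1 by rewrite invr_gt0.
rewrite lee_fin normrM (gtr0_norm Vr') normrM normr_id mulrC.
by rewrite ler_wpM2r// (le_trans Vc)// ler_norm.
Qed.

Let psi r := g r / V r.
Let intpsi : leb.-integrable `[s, t] (EFin \o psi) := integrable_quot_primitive.

(** Both the increment of ln V and the integral of g/V lie within e times the integral of |g| of the
    common value c (V y - V x). *)
Let log_increment e c x y : 0 < e -> s <= x -> x <= y -> y <= t ->
  (forall r, x <= r <= y -> `|(V r)^-1 - c| <= e) ->
  `|ln (V y) - ln (V x) - \int[leb]_(r in `[x, y]) psi r|
   <= (e + e) * \int[leb]_(r in `[x, y]) `|g r|.
Proof.
move=> e0 sx xy yt close.
have ig := integrable_subitv sx yt intg.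
have ipsi := integrable_subitv sx yt intpsi.
have iag : leb.-integrable `[x, y] (EFin \o (fun r => `|g r|)).
  exact: (integrable_norm ig).
have icg : leb.-integrable `[x, y] (EFin \o (fun r => c * g r)).
  by apply: (integrableZl _ c ig).
set G := \int[leb]_(r in `[x, y]) `|g r|.
have Vx : 0 < V x by apply: V0; rewrite sx (le_trans xy).
have Vy : 0 < V y by apply: V0; rewrite yt (le_trans sx).
have dG : `|V y - V x| <= G by rewrite (Vg sx xy yt) le_normr_Rintegral.
have h1 : `|ln (V y) - ln (V x) - c * (V y - V x)| <= e * G.
  have /andP[lo hi] := ln_diff_bounds Vx Vy.
  have cx := close x ltac:(by rewrite lexx).
  have cy := close y ltac:(by rewrite lexx xy).
  have bound r : `|r - c| <= e -> `|(V y - V x) * (r - c)| <= e * G.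
    by move=> re; rewrite normrM mulrC ler_pM.
  have := bound _ cx; have := bound _ cy; rewrite !ler_norml.
  move=> /andP[b1 b2] /andP[b3 b4]; apply/andP; split; lra.
have h2 : `|c * (V y - V x) - \int[leb]_(r in `[x, y]) psi r| <= e * G.
  rewrite (Vg sx xy yt) -RintegralZl// -RintegralB//.
  apply: (le_trans (le_normr_Rintegral _ _)) => //.
    by apply: (integrableB _ icg ipsi).
  rewrite -RintegralZl//; apply: le_Rintegral => //.
  - apply: (@integrable_norm _ _ _ leb _ (fun r => c * g r - psi r)).
    by apply: (integrableB _ icg ipsi).
  - by apply: (integrableZl _ e iag).
  - move=> r; rewrite /= in_itv/= => /close cl.
    rewrite (_ : c * g r - psi r = - (((V r)^-1 - c) * g r)); last by rewrite /psi; ring.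
    by rewrite normrN normrM ler_wpM2r.
rewrite mulrDl; apply: le_trans (lerD h1 h2).
by apply: le_trans (ler_normD _ _); rewrite addrA subrK.
Qed.

(** For every e > 0 the increments of H = ln V - int psi are locally at most e times those of G =
    int |g|. Thus e G + H and e G - H are locally nondecreasing, which gives |H t - H s| <= e G t,
    and e is arbitrary. *)
Lemma ln_primitive :
  \int[leb]_(r in `[s, t]) (g r / V r) = ln (V t) - ln (V s).
Proof.
pose G x := \int[leb]_(r in `[s, x]) `|g r|.
pose H x := ln (V x) - \int[leb]_(r in `[s, x]) psi r.
have iag : leb.-integrable `[s, t] (EFin \o (fun r => `|g r|)).
  exact: (integrable_norm intg).
have loc e c : 0 < e -> s <= c <= t -> exists2 d, 0 < d &
    forall x y, s <= x -> x <= y -> y <= t -> `|x - c| < d -> `|y - c| < d ->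
      `|H y - H x| <= e * (G y - G x).
  (* Half of e, since [log_increment] spends the closeness of 1/V twice. *)
  move=> e0 cst; have e20 : 0 < e / 2 by rewrite divr_gt0.
  have cst' : `[s, t]%classic c by rewrite /= in_itv.
  have /cvgrPdist_le/(_ _ e20)[d /= d0 Hd] := (subspace_continuousP _ _).1 cW c cst'.
  exists d => // x y sx xy yt xd yd.
  have -> : G y - G x = \int[leb]_(r in `[x, y]) `|g r|.
    exact: Rintegral_itv_split iag.
  have -> : H y - H x = ln (V y) - ln (V x) - \int[leb]_(r in `[x, y]) psi r.
    by rewrite -(Rintegral_itv_split sx xy yt intpsi) /H; ring.
  have -> : e = e / 2 + e / 2 by field.
  apply: (@log_increment _ (V c)^-1) => // r /andP[xr ry].
  rewrite distrC; apply: Hd => /=; last by rewrite in_itv/=; apply/andP; split; lra.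
  by rewrite distrC; move: xd yd; rewrite !ltr_norml => /andP[? ?] /andP[? ?]; apply/andP; split; lra.
have Gs : G s = 0 by rewrite /G set_itv1 Rintegral_set1.
have Hs : H s = ln (V s) by rewrite /H set_itv1 Rintegral_set1 subr0.
have bound e : 0 < e -> `|H t - H s| <= e * G t.
  move=> e0; rewrite -[G t]subr0 -Gs.
  have up : e * G s + H s <= e * G t + H t.
    apply: (@locally_nondecreasing_le (fun x => e * G x + H x)) => // c cst.
    have [d d0 Hd] := loc e c e0 cst; exists d => // x y sx xy yt xd yd.
    by have := Hd _ _ sx xy yt xd yd; rewrite ler_norml => /andP[? ?]; lra.
  have dn : e * G s - H s <= e * G t - H t.
    apply: (@locally_nondecreasing_le (fun x => e * G x - H x)) => // c cst.
    have [d d0 Hd] := loc e c e0 cst; exists d => // x y sx xy yt xd yd.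
    by have := Hd _ _ sx xy yt xd yd; rewrite ler_norml => /andP[? ?]; lra.
  by rewrite ler_norml; apply/andP; split; lra.
have : H t = H s.
  have G0 : 0 <= G t by apply: Rintegral_ge0.
  apply/eqP; rewrite -subr_eq0 -normr_le0; apply/ler_addgt0Pr => e e0.
  (* The added 1 covers the case G t = 0. *)
  rewrite add0r; have e1 : 0 < e / (G t + 1) by rewrite divr_gt0// ltr_wpDl.
  apply: (le_trans (bound _ e1)); rewrite mulrAC ler_pdivrMr ?ltr_wpDl//.
  by rewrite ler_pM2l// lerDl.
by rewrite Hs /H /psi => /eqP; rewrite subr_eq => /eqP ->; ring.
Qed.

End LogIntegral.

(** * The evolution equation near the origin *)

Lemma ae_imply d (T : measurableType d) (R : realType)
    (mu : {measure set T -> \bar R}) (P Q : T -> Prop) :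
  (forall x, P x -> Q x) -> {ae mu, forall x, P x} -> {ae mu, forall x, Q x}.
Proof.
move=> PQ [N [mN N0 sN]]; exists N; split=> // x nQ; apply: sN => /=.
by apply: contra_not nQ; exact: PQ.
Qed.

Lemma ae_le_integral d (T : measurableType d) (R : realType)
    (mu : {measure set T -> \bar R}) (D : set T) (f g : T -> \bar R) :
  measurable D -> mu.-integrable D f -> mu.-integrable D g ->
  {ae mu, forall x, D x -> (f x <= g x)%E} ->
  (\int[mu]_(x in D) f x <= \int[mu]_(x in D) g x)%E.
Proof.
move=> mD intf intg [N [mN N0 sN]].
rewrite (negligible_integral mN mD intf N0) (negligible_integral mN mD intg N0).
apply: le_integral.
- exact: measurableD.
- by apply: integrableS intf ; [by []|exact: measurableD|exact: subDsetl].
- by apply: integrableS intg ; [by []|exact: measurableD|exact: subDsetl].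
- move=> x /set_mem [Dx Nx]; apply: contrapT => nle; apply: Nx; apply: sN => /=.
  by move=> /(_ Dx).
Qed.

Section Evolution.
Context {R : realType}.
Local Notation leb := (@lebesgue_measure R).
Implicit Types r s t z w x y : R.
Variables (v : R -> R -> R -> R) (q a b : R -> R) (pi : R -> {measure set R -> \bar R}).
Let phi := herglotz q a b pi.
Let m r := dat0 (fun z => phi z r).
Hypothesis Hv : ac_reverse_evolution_family v.
Hypothesis Hl : levy_family q a b pi.
Hypothesis Hh : associated_herglotz v phi.
Hypothesis v_homo : forall s t z w, 0 <= s <= t -> 0 < z -> z <= w ->
  v s t z <= v s t w.
Hypothesis v_at0 : forall s t, 0 <= s <= t -> at0 (v s t) = 0%E ->
  v s t z @[z --> 0^'+] --> (0 : R).
Hypothesis v_quot : forall s t, 0 <= s <= t -> at0 (v s t) = 0%E ->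
  (v s t z / z)%:E @[z --> 0^'+] --> dat0 (v s t).

Let v_gt0 s t z : 0 <= s <= t -> 0 < z -> 0 < v s t z.
Proof. by case: Hv => H _ _ _; exact: H. Qed.

Let q_ge0 r : 0 <= r -> 0 <= q r.
Proof. by case: Hl => H _ _ _ /H []. Qed.

Let b_ge0 r : 0 <= r -> 0 <= b r.
Proof. by case: Hl => H _ _ _ /H []. Qed.

Let pi_fin r : 0 <= r -> (\int[pi r]_x (Num.min 1 (x ^+ 2)%R)%:E < +oo)%E.
Proof. by case: Hl => _ _ H _ /H. Qed.

Lemma herglotz_at0 r : 0 <= r -> at0 (fun z => phi z r) = (- q r)%:E.
Proof. by move=> r0; exact: (at0_levy_khintchine (q r) (a r) (b r) (pi_fin r0)). Qed.

Lemma herglotz_dat0 r : 0 <= r ->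
  m r = ((a r)%:E - \int[pi r]_(x in [set x : R | (1 <= x)%R]) x%:E)%E.
Proof. by move=> r0; exact: (dat0_levy_khintchine (q r) (a r) (b r) (pi_fin r0)). Qed.

(** Unlike phi / z, this tends to [m r] even where q r > 0; the pole is kept apart as the term q / v
    in [psiE]. *)
Let quot z r := (phi z r + q r) / z.

Let quot_homo r z w : 0 <= r -> 0 < z -> z <= w -> quot z r <= quot w r.
Proof.
move=> r0.
exact: (levy_khintchine_quot_homo (q r) (a r) (b_ge0 r0) (pi_fin r0)).
Qed.

Let quot_cvg r : 0 <= r -> (quot z r)%:E @[z --> 0^'+] --> m r.
Proof.
move=> r0; rewrite herglotz_dat0//.
exact: (@cvg_levy_khintchine_quot R (q r) (a r) (b r) (pi r) (pi_fin r0)).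
Qed.

Let m_le_quot r z : 0 <= r -> 0 < z -> (m r <= (quot z r)%:E)%E.
Proof.
move=> r0 z0; apply: (cvge_to_le (quot_cvg r0)); near=> w.
by rewrite lee_fin quot_homo//; near: w; exact: nbhs_right_le.
Unshelve. all: by end_near. Qed.

Let g t z r := phi (v r t z) r.
Let psi t z r := g t z r / v r t z.

Let g_int t z : 0 <= t -> 0 < z -> leb.-integrable `[0, t] (EFin \o g t z).
Proof. by move=> t0 z0; have [] := Hh t0 z0. Qed.

Let v_increment t z : 0 <= t -> 0 < z -> forall x y, 0 <= x -> x <= y -> y <= t ->
  v y t z - v x t z = \int[leb]_(r in `[x, y]) g t z r.
Proof.
move=> t0 z0 x y x0 xy yt; have [int E] := Hh t0 z0.
rewrite (E y) ?(E x) ?x0 ?(le_trans xy yt) ?(le_trans x0 xy) ?yt//.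
have int' := integrable_subitv x0 (lexx t) int.
rewrite -/(Rintegral leb `[y, t] (g t z)) -/(Rintegral leb `[x, t] (g t z)).
by rewrite -(Rintegral_itv_split xy yt (lexx t) int'); ring.
Qed.

Let v_pos t z : 0 < z -> forall x, 0 <= x <= t -> 0 < v x t z.
Proof. by move=> z0 x xt; exact: v_gt0. Qed.

Let psi_int t z : 0 <= t -> 0 < z -> leb.-integrable `[0, t] (EFin \o psi t z).
Proof.
by move=> t0 z0; exact: (integrable_quot_primitive t0 (g_int t0 z0)
  (v_increment t0 z0) (v_pos z0)).
Qed.

Lemma ln_evolution s t z : 0 <= s <= t -> 0 < z ->
  ln (v s t z) = ln z - \int[leb]_(r in `[s, t]) psi t z r.
Proof.
move=> /andP[s0 st] z0; have t0 := le_trans s0 st.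
have E := @ln_primitive R (fun r => v r t z) (g t z) s t st.
rewrite /psi E.
- case: Hv => _ idv _ _; rewrite idv//; ring.
- exact: integrable_subitv s0 (lexx t) (g_int t0 z0).
- by move=> x y sx; apply: v_increment => //; exact: le_trans sx.
- by move=> x /andP[sx xt]; apply: v_pos => //; rewrite xt (le_trans s0).
Qed.

Let psiE t z r : psi t z r = quot (v r t z) r - q r / v r t z.
Proof. by rewrite /psi /quot /g; ring. Qed.

(** In [psiE] both terms are nondecreasing in v, the second because q r >= 0, and v_{r,t} is
    nondecreasing in z. *)
Let psi_homo t z w r : 0 <= r <= t -> 0 < z -> z <= w -> psi t z r <= psi t w r.
Proof.
move=> rt z0 zw; have /andP[r0 _] := rt; have w0 := lt_le_trans z0 zw.
rewrite !psiE lerB//; first by apply: quot_homo => //; [exact: v_gt0|exact: v_homo].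
rewrite ler_wpM2l ?q_ge0// lef_pV2 ?posrE ?v_gt0//; exact: v_homo.
Qed.

Let m_le_psi t z r : 0 <= r <= t -> 0 < z -> q r = 0 -> (m r <= (psi t z r)%:E)%E.
Proof.
move=> rt z0 q0; rewrite psiE q0 mul0r subr0; apply: m_le_quot; last exact: v_gt0.
by case/andP: rt.
Qed.

Let C5 := {ae leb, forall t, 0 <= t -> at0 (fun z => phi z t) = 0%E} /\
  (forall T : R, 0 <= T -> leb.-integrable `[0, T] m).

Let C6 := {ae leb, forall t, 0 <= t -> q t = 0} /\
  (forall T : R, 0 <= T -> leb.-integrable `[0, T]
     (fun t => \int[pi t]_(x in [set x : R | (1 <= x)%R]) (x%:E))%E).

Let at0_q r : 0 <= r -> at0 (fun z => phi z r) = 0%E <-> q r = 0.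
Proof.
move=> r0; rewrite herglotz_at0//; split => [[] /eqP|->]; last by rewrite oppr0.
by rewrite oppr_eq0 => /eqP.
Qed.

Let ae_q : {ae leb, forall t, 0 <= t -> at0 (fun z => phi z t) = 0%E} <->
  {ae leb, forall t, 0 <= t -> q t = 0}.
Proof.
by split; apply: ae_imply => t H t0; have /(at0_q t0) := H t0.
Qed.

Let a_int T : 0 <= T -> leb.-integrable `[0, T] (fun t => (a t)%:E).
Proof. by case: Hl => _ _ _ H /H []. Qed.

Let q_int T : 0 <= T -> leb.-integrable `[0, T] (fun t => (q t)%:E).
Proof. by case: Hl => _ _ _ H /H []. Qed.

Lemma herglotz_levy_iff : C5 <-> C6.
Proof.
split=> -[/ae_q aeq H]; split=> // T T0.
  apply: eq_integrable (integrableB _ (a_int T0) (H T T0)) => // r.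
  rewrite inE/= in_itv/= => /andP[r0 _]; rewrite herglotz_dat0//.
  (* The identity a - (a - G) = G survives G = +oo because a is finite. *)
  by case: (integral _ _ _) => [x| |]//; rewrite -!EFinB subKr.
apply: eq_integrable (integrableB _ (a_int T0) (H T T0)) => // r.
by rewrite inE/= in_itv/= => /andP[r0 _]; rewrite herglotz_dat0.
Qed.

Lemma evolution_le s t z : C5 -> 0 <= s <= t -> 0 < z ->
  v s t z <= z * expR (- fine (\int[leb]_(r in `[s, t]) m r)%E).
Proof.
move=> [/ae_q aeq mint] st z0; have /andP[s0 st'] := st.
have t0 := le_trans s0 st'.
have ms := integrable_subitv s0 (lexx t) (mint t t0).
have ps := integrable_subitv s0 (lexx t) (psi_int t0 z0).
rewrite -ler_ln ?posrE ?mulr_gt0 ?expR_gt0 ?v_gt0//.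
rewrite lnM ?posrE ?expR_gt0// expRK ln_evolution// lerD2l lerN2.
apply: fine_le; [exact: integrable_fin_num|exact: integrable_fin_num|].
apply: ae_le_integral => //; apply: ae_imply aeq => r q0.
rewrite /= in_itv/= => /andP[sr rt]; have r0 := le_trans s0 sr.
by apply: m_le_psi => //; [rewrite r0|exact: q0].
Qed.

(** The single bound v <= z K gives both claims: v tends to 0, and K bounds the limit of v / z. *)
Lemma herglotz_evolution : C5 -> forall s t, 0 <= s <= t ->
  at0 (v s t) = 0%E /\ (dat0 (v s t) < +oo)%E.
Proof.
move=> c5 s t st; pose K := expR (- fine (\int[leb]_(r in `[s, t]) m r)%E).
have v0 : at0 (v s t) = 0%E.
  apply/cvg_lim => //; apply: cvg_EFin; first exact: nearW.
  apply: (@squeeze_cvgr _ _ _ _ (fun=> 0) (fun z => z * K)).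
  - near=> z; have z0 : 0 < z by [].
    by rewrite (ltW (v_gt0 st z0)) evolution_le.
  - exact: cvg_cst.
  - have : z * K @[z --> 0^'+] --> (0 * K : R).
      by apply: cvgMl; exact: cvg_at_right_filter.
    by rewrite mul0r.
split=> //; apply: (@le_lt_trans _ _ K%:E); last exact: ltry.
apply: (cvge_to_le (v_quot st v0)); near=> z.
by rewrite lee_fin ler_pdivrMr// mulrC evolution_le.
Unshelve. all: by end_near. Qed.

Let cvg_along_harmonic (f : R -> \bar R) (l : \bar R) :
  f @ 0^'+ --> l -> (f \o harmonic) @ \oo --> l.
Proof. by move=> fl; exact: (cvg_comp _ _ cvg_harmonic_right fl). Qed.

Let quot_cvg_along r (u : nat -> R) : 0 <= r -> (forall n, 0 < u n) ->
  u n @[n --> \oo] --> (0 : R) -> (quot (u n) r)%:E @[n --> \oo] --> m r.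
Proof.
move=> r0 u0 ucvg; have ur : u n @[n --> \oo] --> 0^'+.
  move=> A [e /= e0 eA]; have /cvgrPdist_lt/(_ _ e0)[N _ HN] := ucvg.
  by exists N => // n Nn; apply: eA => //; exact: HN.
exact: (cvg_comp _ _ ur (quot_cvg r0)).
Qed.

Let measurable_q (T : R) : 0 <= T -> measurable_fun `[0, T] q.
Proof. by move=> T0; apply/measurable_EFinP; exact: measurable_int (q_int T0). Qed.

(** * Limits along [harmonic] for a fixed terminal time *)

Section Critical.
Variable T : R.
Hypothesis T0 : 0 <= T.
Let V n r := v r T (harmonic n).
Let Psi n r := psi T (harmonic n) r.

Hypothesis V_cvg : forall r, 0 <= r <= T -> V n r @[n --> \oo] --> (0 : R).

Let Psi_int n : leb.-integrable `[0, T] (EFin \o Psi n).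
Proof. by apply: psi_int => //; exact: harmonic_gt0. Qed.

Let V_gt0 n r : 0 <= r <= T -> 0 < V n r.
Proof. by move=> rT; apply: v_gt0 => //; exact: harmonic_gt0. Qed.

Let Q_cvg r : 0 <= r <= T -> (quot (V n r) r)%:E @[n --> \oo] --> m r.
Proof.
move=> rT; have /andP[r0 _] := rT; apply: quot_cvg_along => // [n|].
  exact: V_gt0.
exact: V_cvg.
Qed.

(** [m] is the pointwise limit of quot (V n r) r = Psi n r + q r / V n r. Here Psi n is measurable
    because it is integrable, and V n because it is continuous in r. *)
Let m_measurable : measurable_fun `[0, T] m.
Proof.
apply: (@emeasurable_fun_cvg _ _ _ `[0, T] (fun n r => (quot (V n r) r)%:E)).
  move=> n; apply/measurable_EFinP.
  apply: (@eq_measurable_fun _ _ _ _ _ (fun r => Psi n r + q r * (V n r)^-1)).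
    by move=> r _; rewrite /Psi psiE subrK.
  apply: measurable_funD.
    by apply/measurable_EFinP; exact: measurable_int (Psi_int n).
  apply: measurable_funM; first exact: measurable_q.
  have z0 := @harmonic_gt0 R n.
  exact: (measurable_inv_primitive T0 (g_int T0 z0) (v_increment T0 z0) (v_pos z0)).
by move=> r; rewrite /= in_itv/=; exact: Q_cvg.
Qed.

Let Psi_anti r : 0 <= r <= T -> nonincreasing_seq (Psi ^~ r).
Proof.
move=> rT j n jn; apply: psi_homo => //; [exact: harmonic_gt0|exact: harmonic_anti].
Qed.

(** Psi n decreases with n but has no sign; subtracting it from the integrable [Psi 0] gives a
    nonnegative nondecreasing sequence, fit for monotone convergence. *)
Let drop n r := (Psi 0%N r - Psi n r)%:E.

Let drop_mono r : 0 <= r <= T -> nondecreasing_seq (drop ^~ r).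
Proof. by move=> rT j n jn; rewrite lee_fin lerD2l lerN2 Psi_anti. Qed.

Let drop_ge0 n r : 0 <= r <= T -> (0 <= drop n r)%E.
Proof. by move=> rT; rewrite lee_fin subr_ge0 Psi_anti. Qed.

Let drop_measurable n : measurable_fun `[0, T] (drop n).
Proof.
apply/measurable_EFinP/measurable_funB; apply/measurable_EFinP.
  exact: measurable_int (Psi_int 0%N).
exact: measurable_int (Psi_int n).
Qed.

Let D r := limn (drop ^~ r).

Let drop_cvg r : 0 <= r <= T -> drop n r @[n --> \oo] --> D r.
Proof. by move=> rT; apply: ereal_nondecreasing_is_cvgn; exact: drop_mono. Qed.

Let D_measurable : measurable_fun `[0, T] D.
Proof.
apply: (@emeasurable_fun_cvg _ _ _ `[0, T] drop) => // r.
Qed.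

(* A positive q r would make Psi n r = quot (V n r) r - q r / V n r tend to -oo. *)
Let D_fin r : 0 <= r <= T -> D r \is a fin_num ->
  q r = 0 /\ m r = (Psi 0%N r - fine (D r))%:E.
Proof.
move=> rT Dfin; have /andP[r0 _] := rT.
have Psi_cvg : Psi n r @[n --> \oo] --> Psi 0%N r - fine (D r).
  have dc : Psi 0%N r - Psi n r @[n --> \oo] --> fine (D r).
    apply: (@fine_cvg _ _ _ _ (drop ^~ r)); rewrite fineK//; exact: drop_cvg.
  have : Psi 0%N r - (Psi 0%N r - Psi n r) @[n --> \oo] --> Psi 0%N r - fine (D r).
    by apply: cvgB => //; exact: cvg_cst.
  by under eq_fun do rewrite subKr.
have q0 : q r = 0.
  apply/eqP; rewrite eq_le q_ge0// andbT.
  (* By [psiE], q r = V n r (quot (V n r) r - Psi n r), which is at most V n r (quot (V 0 r) r - Psi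
     n r); this tends to 0 because Psi n r converges. *)
  have bc : V n r * (quot (V 0%N r) r - Psi n r) @[n --> \oo] -->
      0 * (quot (V 0%N r) r - (Psi 0%N r - fine (D r))).
    apply: cvgM; first exact: V_cvg.
    by apply: cvgB => //; exact: cvg_cst.
  rewrite mul0r in bc; apply: (cvgr_to_ge bc); apply: nearW => n.
  have Vn := V_gt0 n rT; rewrite mulrC -ler_pdivrMr// /Psi psiE.
  have : quot (V n r) r <= quot (V 0%N r) r.
    apply: quot_homo => //; apply: v_homo => //; first exact: harmonic_gt0.
    exact: harmonic_anti.
  rewrite /V; lra.
split=> //; apply: (@cvg_unique _ _ ((fun n => (Psi n r)%:E) @ \oo)).
- exact: ereal_hausdorff.
- have -> : (fun n => (Psi n r)%:E) = (fun n => (quot (V n r) r)%:E).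
    by apply/funext => n; rewrite /Psi psiE q0 mul0r subr0.
  exact: Q_cvg.
- by apply: cvg_EFin => //; exact: nearW.
Qed.

(** By [ln_evolution] the integral of [drop n] is a constant plus ln(v/z), hence bounded above for
    large n. Its monotone limit D is therefore integrable, thus finite almost everywhere, and
    [D_fin] applies. *)
Lemma critical_integrable (K : R) :
  (\forall n \near \oo, v 0 T (harmonic n) / harmonic n <= K) ->
  {ae leb, forall r, 0 <= r <= T -> q r = 0} /\ leb.-integrable `[0, T] m.
Proof.
move=> HK; pose I0 := \int[leb]_(r in `[0%R, T]) Psi 0%N r.
have int_drop n : (\int[leb]_(r in `[0%R, T]) drop n r =
    (I0 + ln (v 0 T (harmonic n) / harmonic n))%:E)%E.
  have z0 := @harmonic_gt0 R n; have T00 : 0 <= (0 : R) <= T by rewrite lexx.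
  rewrite ln_div ?posrE ?v_gt0// ln_evolution//.
  transitivity (\int[leb]_(r in `[0%R, T]) (Psi 0%N r - Psi n r))%:E.
    rewrite /Rintegral fineK//; apply: integrable_fin_num => //.
    by apply: (integrableB _ (Psi_int 0%N) (Psi_int n)).
  by rewrite RintegralB//; congr EFin; rewrite /I0 /Psi; ring.
have D_int : leb.-integrable `[0, T] D.
  have c : (\int[leb]_(r in `[0%R, T]) drop n r)%E @[n --> \oo] -->
      (\int[leb]_(r in `[0%R, T]) D r)%E.
    by apply: cvg_monotone_convergence => //.
  apply/integrableP; split=> //.
  have -> : (\int[leb]_(r in `[0%R, T]) `|D r| = \int[leb]_(r in `[0%R, T]) D r)%E.
    apply: eq_integral => r; rewrite inE/= in_itv/= => rT; rewrite gee0_abs//.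
    apply: (cvge_to_ge (drop_cvg rT)); apply: nearW => n; exact: drop_ge0.
  apply: (@le_lt_trans _ _ (I0 + ln K)%:E); last exact: ltry.
  apply: (cvge_to_le c); near=> n.
  have vn : 0 < v 0 T (harmonic n) / harmonic n.
    by rewrite divr_gt0 ?harmonic_gt0// v_gt0 ?lexx// harmonic_gt0.
  have vK : v 0 T (harmonic n) / harmonic n <= K by near: n.
  by rewrite int_drop lee_fin lerD2l ler_ln ?posrE// (lt_le_trans vn).
have Dae : {ae leb, forall r, `[0, T]%classic r -> D r \is a fin_num}.
  exact: integrable_ae.
split.
  apply: ae_imply Dae => r H rT.
  by have [] := D_fin rT (H _); rewrite ?in_itv.
apply/integrableP; split=> //.
have ib : leb.-integrable `[0, T] (fun r => `|(Psi 0%N r)%:E| + `|D r|)%E.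
  apply: integrableD => //; apply: integrable_abse => //; exact: Psi_int.
apply: (@le_lt_trans _ _ (\int[leb]_(r in `[0%R, T]) (`|(Psi 0%N r)%:E| + `|D r|))%E).
  apply: ae_ge0_le_integral => //.
  - exact: measurableT_comp.
  - by move=> r _; exact: adde_ge0.
  - exact: measurable_int ib.
  - apply: ae_imply Dae => r H rT.
    have rT' : 0 <= r <= T by move: rT; rewrite /= in_itv.
    have Df := H rT; have [_ ->] := D_fin rT' Df.
    rewrite -(fineK Df) /= -EFinD lee_fin; exact: ler_normB.
exact: integrable_lty.
Unshelve. all: by end_near. Qed.

(** Almost everywhere Psi n lies between m and Psi 0, so |Psi 0| + |m| is an integrable dominating
    function. *)
Lemma evolution_quot_cvg s : C5 -> 0 <= s <= T ->
  v s T (harmonic n) / harmonic n @[n --> \oo] -->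
  expR (- fine (\int[leb]_(r in `[s, T]) m r)%E).
Proof.
move=> [/ae_q aeq mint] sT; have /andP[s0 sT'] := sT.
have ms := integrable_subitv s0 (lexx T) (mint T T0).
have ps n := integrable_subitv s0 (lexx T) (Psi_int n).
have sub r : `[s, T]%classic r -> 0 <= r <= T.
  by rewrite /= in_itv/= => /andP[sr ->]; rewrite (le_trans s0).
have ib : leb.-integrable `[s, T] (fun r => `|(Psi 0%N r)%:E| + `|m r|)%E.
  by apply: integrableD => //; apply: integrable_abse => //; exact: ps.
have h1 : {ae leb, forall r, `[s, T]%classic r ->
    (Psi n r)%:E @[n --> \oo] --> m r}.
  apply: ae_imply aeq => r q0 /sub rT; have /andP[r0 _] := rT.
  have -> : (fun n => (Psi n r)%:E) = (fun n => (quot (V n r) r)%:E).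
    by apply/funext => n; rewrite /Psi psiE q0// mul0r subr0.
  exact: Q_cvg.
have h2 : {ae leb, forall r n, `[s, T]%classic r ->
    (`|(Psi n r)%:E| <= `|(Psi 0%N r)%:E| + `|m r|)%E}.
  apply: ae_imply aeq => r q0 n /sub rT; have /andP[r0 _] := rT.
  have lo := m_le_psi rT (harmonic_gt0 n) (q0 r0).
  have hi := Psi_anti rT (leq0n n).
  move: lo; case: (m r) => [x| |]//=; last by rewrite leey.
  rewrite !lee_fin -/(Psi n r) => lo.
  have := ler_norm (Psi 0%N r); have := ler_norm (- x); rewrite normrN.
  have := normr_ge0 (Psi 0%N r); have := normr_ge0 x.
  by rewrite ler_norml => *; apply/andP; split; lra.
have c : (\int[leb]_(r in `[s, T]) (Psi n r)%:E)%E @[n --> \oo] -->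
    (\int[leb]_(r in `[s, T]) m r)%E.
  have mPsi n : measurable_fun `[s, T] (fun r => (Psi n r)%:E).
    exact: measurable_int (ps n).
  have mm : measurable_fun `[s, T] m by exact: measurable_int ms.
  by have [] := @dominated_convergence _ _ R leb `[s, T] _ _ m _ mPsi mm h1 ib h2.
have E n : v s T (harmonic n) / harmonic n = expR (- \int[leb]_(r in `[s, T]) Psi n r).
  have z0 := @harmonic_gt0 R n.
  rewrite -[LHS]lnK ?posrE ?divr_gt0 ?v_gt0// ln_div ?posrE ?v_gt0//.
  by rewrite ln_evolution//; congr expR; rewrite /Psi; ring.
under eq_fun do rewrite E.
apply: continuous_cvg; first exact: continuous_expR.
apply: cvgN; apply: fine_cvg; rewrite fineK; last exact: integrable_fin_num.
exact: c.
Qed.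

End Critical.

Lemma evolution_herglotz :
  (forall t, 0 <= t -> at0 (v 0 t) = 0%E /\ (dat0 (v 0%R t) < +oo)%E) -> C5.
Proof.
move=> c3.
have main T : 0 <= T ->
    {ae leb, forall r, 0 <= r <= T -> q r = 0} /\ leb.-integrable `[0, T] m.
  move=> T0; have [at0v dat0v] := c3 _ T0.
  have T00 : 0 <= (0 : R) <= T by rewrite lexx.
  have vq := v_quot T00 at0v; have v0 := v_at0 T00 at0v.
  have V_cvg r : 0 <= r <= T -> v r T (harmonic n) @[n --> \oo] --> (0 : R).
    move=> rT; have /andP[r0 rT'] := rT.
    apply/cvgrPdist_lt => e e0.
    have r00 : 0 <= (0 : R) <= r by rewrite lexx.
    (* If v_{r,T} were at least e at [harmonic n], then v_{0,T} would be at least v_{0,r}(e) > 0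
       there, impossible for large n. *)
    have ve : 0 < v 0 r e by exact: v_gt0.
    have v0n := cvg_comp _ _ cvg_harmonic_right v0.
    near=> n; have vn := v_gt0 rT (harmonic_gt0 n).
    rewrite sub0r normrN gtr0_norm// ltNge; apply/negP => evn.
    have : v 0 T (harmonic n) < v 0 r e.
      near: n; exact: (cvgr_lt 0 v0n).
    have -> : v 0 T (harmonic n) = v 0 r (v r T (harmonic n)).
      by case: Hv => _ _ comp _; apply: comp => //; exact: harmonic_gt0.
    by rewrite ltNge v_homo.
  have dge0 : (0 <= dat0 (v 0%R T))%E.
    apply: (cvge_to_ge vq); near=> z; rewrite lee_fin divr_ge0//.
    by rewrite ltW// v_gt0.
  have dfin : dat0 (v 0%R T) \is a fin_num by rewrite ge0_fin_numE.
  rewrite -(fineK dfin) in vq.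
  have vqn : v 0 T (harmonic n) / harmonic n @[n --> \oo] --> fine (dat0 (v 0%R T)).
    exact: (fine_cvg (cvg_along_harmonic vq)).
  (* The quotients converge to the derivative at 0, so they eventually stay below that derivative
     plus 1. *)
  apply: (critical_integrable T0 V_cvg (K := fine (dat0 (v 0%R T)) + 1)).
  by apply: (cvgr_le (fine (dat0 (v 0%R T))) vqn); rewrite ltrDl.
split; last by move=> T /main [].
apply/ae_q.
(* The null set depends on the horizon; integer horizons cover all times, and a countable union of
   null sets is null. *)
have H : {ae leb, forall r, forall n : nat, 0 <= r <= n%:R -> q r = 0}.
  by apply/ae_foralln => n; have [] := main n%:R (ler0n _ _).
apply: ae_imply H => r H r0; apply: (H (Num.truncn r).+1).
by rewrite r0 ltW// truncnS_gt.
Unshelve. all: by end_near. Qed.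

(** The same quotients v / z along [harmonic] have both sides as limits, by [v_quot] and by
    [evolution_quot_cvg]. *)
Lemma dat0_evolution s t : C5 -> 0 <= s <= t ->
  dat0 (v s t) = (expR (- fine (\int[leb]_(r in `[s, t]) m r)%E))%:E.
Proof.
move=> c5 st; have /andP[s0 st'] := st; have t0 := le_trans s0 st'.
have c4 := herglotz_evolution c5.
have V_cvg r : 0 <= r <= t -> v r t (harmonic n) @[n --> \oo] --> (0 : R).
  move=> rt; exact: (cvg_comp _ _ cvg_harmonic_right (v_at0 rt (c4 _ _ rt).1)).
have c := evolution_quot_cvg t0 V_cvg c5 st.
apply: (@cvg_unique _ _ ((fun n => (v s t (harmonic n) / harmonic n)%:E) @ \oo)).
- exact: ereal_hausdorff.
- exact: (cvg_along_harmonic (v_quot st (c4 _ _ st).1)).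
- by apply: cvg_EFin => //; exact: nearW.
Qed.

End Evolution.

(** * Means of the branching process *)

(* The Markov property at time s, tested on the event [Z s = x]. *)
Lemma branching_mean (R : realType) (d : measure_display) (Omega : measurableType d)
    (F : R -> R -> set (set Omega)) (P : R -> \bar R -> probability Omega R)
    (Z : R -> Omega -> \bar R) (k : R -> R -> \bar R -> probability (\bar R) R)
    (s t : R) (x : \bar R) :
  branching_process F P Z k -> 0 <= s <= t -> Sp x ->
  (\int[P s x]_w Z t w = \int[k s t x]_y `|y|)%E.
Proof.
move=> [_ [Zpos [Fsig [_ [adapted [start markov]]]]]] st Spx.
have /andP[s0 st'] := st; have t0 := le_trans s0 st'.
pose A := [set w | Z s w = x].
have FA : F s s A by apply: (adapted s s s [set x]); rewrite ?s0 ?lexx.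
have ss : 0 <= s <= s by rewrite s0 lexx.
have mA : measurable A by have [_] := Fsig s s ss; apply.
have PA : P s x A = 1%E by exact: start.
have PA0 : P s x (~` A) = 0%E by rewrite probability_setC// PA subee.
have mZ : measurable_fun setT (fun w => `|Z t w|%E).
  apply: measurableT_comp => // _ B mB; rewrite setTI.
  by have [_] := Fsig s t st; apply; apply: adapted => //; rewrite s0 st'.
(* The Markov property is stated for functions nonnegative on all of [\bar R]; [abse] is one, and it
   agrees with the identity on [Sp]. *)
transitivity (\int[P s x]_w `|Z t w|)%E.
  by apply: eq_integral => w _; rewrite gee0_abs//; exact: Zpos.
rewrite (ge0_negligible_integral (measurableC mA) measurableT)//.
rewrite setTD setCK (markov s s t x abse)//.
transitivity (\int[P s x]_(w in A) (cst (\int[k s t x]_y `|y|) w))%E.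
  by apply: eq_integral => w /set_mem ->.
by rewrite integral_cst// -[RHS]mule1 -PA.
Qed.

Section LaplaceExponents.
Context {R : realType}.
Variables (k : R -> R -> \bar R -> probability (\bar R) R) (v : R -> R -> R -> R).
Hypothesis Hk : branching_kernels k.
Hypothesis Hlap : laplace_exponents k v.
Implicit Types s t x z w : R.

Let kSp s t x : 0 <= s <= t -> 0 <= x -> k s t x%:E Sp = 1%E.
Proof. by case: Hk => H _ st x0; apply: H => //; rewrite /Sp /= lee_fin. Qed.

Let lapE s t x : 0 <= s <= t -> 0 <= x -> forall z, 0 < z ->
  (\int[k s t x%:E]_(y in fpos) (expR (- z * fine y)%R)%:E =
   (expR (- (x * v s t z)))%:E)%E.
Proof. by move=> st x0 z z0; rewrite Hlap// mulNr. Qed.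

Let lap1 s t : 0 <= s <= t -> forall z, 0 < z ->
  (\int[k s t 1%:E]_(y in fpos) (expR (- z * fine y)%R)%:E =
   (expR (- v s t z))%:E)%E.
Proof. by move=> st z z0; rewrite lapE// mul1r. Qed.

Lemma evolution_homo s t z w : 0 <= s <= t -> 0 < z -> z <= w ->
  v s t z <= v s t w.
Proof. by move=> st; exact: (laplace_exponent_homo (lap1 st)). Qed.

Lemma evolution_cvg0 s t : 0 <= s <= t -> at0 (v s t) = 0%E ->
  v s t z @[z --> 0^'+] --> (0 : R).
Proof.
move=> st /(at0_laplace_exponent (lap1 st)) m1.
by have := cvg_laplace_exponent (lap1 st); rewrite m1/= ln1 oppr0.
Qed.

Lemma evolution_quot s t : 0 <= s <= t -> at0 (v s t) = 0%E ->
  (v s t z / z)%:E @[z --> 0^'+] --> dat0 (v s t).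
Proof. by move=> st /(mean_at0 (lap1 st)) [->]. Qed.

Lemma unit_mean_ltyP s t : 0 <= s <= t ->
  (\int[k s t 1%:E]_y `|y| < +oo)%E <->
  at0 (v s t) = 0%E /\ (dat0 (v s t) < +oo)%E.
Proof. by move=> st; apply: (mean_ltyP (kSp st ler01) (lap1 st)). Qed.

(** The law started at x has exponent x v_{s,t}, so its mean is the limit of x v / z. Working with
    this quotient reduces everything to the limit of v / z. *)
Lemma mean_evolution s t x : 0 <= s <= t -> 0 < x -> at0 (v s t) = 0%E ->
  (\int[k s t x%:E]_y `|y| = x%:E * dat0 (v s t))%E.
Proof.
move=> st x0 v0; have lx := lapE st (ltW x0).
have u0 : at0 (fun z => x * v s t z) = 0%E.
  apply/cvg_lim => //; apply: cvg_EFin; first exact: nearW.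
  have : x * v s t z @[z --> 0^'+] --> x * 0.
    by apply: cvgMr; exact: evolution_cvg0.
  by rewrite mulr0.
have [_ c] := mean_at0 lx u0.
have c' : (x%:E * (v s t z / z)%:E)%E @[z --> 0^'+] --> (x%:E * dat0 (v s t))%E.
  by apply: cvgeZl => //; exact: evolution_quot.
apply: (cvg_unique _ c) => //; apply: cvg_trans c'.
by apply: near_eq_cvg; apply: nearW => z; rewrite -EFinM mulrA.
Qed.

End LaplaceExponents.

Theorem mainTheorem4 (R : realType) (d : measure_display) (Omega : measurableType d)
    (F : R -> R -> set (set Omega)) (P : R -> \bar R -> probability Omega R)
    (Z : R -> Omega -> \bar R) (k : R -> R -> \bar R -> probability (\bar R) R)
    (v : R -> R -> R -> R) (q a b : R -> R) (pi : R -> {measure set R -> \bar R}) :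
  branching_process F P Z k ->
  laplace_exponents k v ->
  ac_reverse_evolution_family v ->
  levy_family q a b pi ->
  associated_herglotz v (herglotz q a b pi) ->
  let phi := herglotz q a b pi in
  let leb := @lebesgue_measure R in
  (* (1) *)
  let C1 := forall s t x : R, 0 <= s <= t -> 0 < x ->
              (\int[P s x%:E]_w Z t w < +oo)%E in
  (* (2) *)
  let C2 := forall t : R, 0 <= t -> (\int[P 0%R 1%:E]_w Z t w < +oo)%E in
  (* (3) *)
  let C3 := forall t : R, 0 <= t -> at0 (v 0 t) = 0%E /\ (dat0 (v 0%R t) < +oo)%E in
  (* (4) *)
  let C4 := forall s t : R, 0 <= s <= t ->
              at0 (v s t) = 0%E /\ (dat0 (v s t) < +oo)%E in
  (* (5) *)
  let C5 := {ae leb, forall t, 0 <= t -> at0 (fun z => phi z t) = 0%E} /\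
            (forall T : R, 0 <= T ->
               leb.-integrable `[0, T] (fun t => dat0 (fun z => phi z t))) in
  (* (6) *)
  let C6 := {ae leb, forall t, 0 <= t -> q t = 0} /\
            (forall T : R, 0 <= T ->
               leb.-integrable `[0, T]
                 (fun t => \int[pi t]_(x in [set x : R | (1 <= x)%R]) (x%:E))%E) in
  [/\ C1 <-> C2, C2 <-> C3, C3 <-> C4, C4 <-> C5 &
      (C5 <-> C6) /\
      (C1 -> forall s t x : R, 0 <= s <= t -> 0 < x ->
         (\int[P s x%:E]_w Z t w = x%:E * dat0 (v s t))%E /\
         (\int[P s x%:E]_w Z t w
            = (x * expR (- fine (\int[leb]_(r in `[s, t]) dat0 (fun z => phi z r))%E))%:E)%E)].
Proof.
move=> bp lap Hv Hl Hh phi leb C1 C2 C3 C4 C5 C6.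
have Hk : branching_kernels k by case: bp.
have vh := evolution_homo lap.
have v0 := evolution_cvg0 lap.
have vq := evolution_quot lap.
have meanE s t x : 0 <= s <= t -> 0 < x ->
    (\int[P s x%:E]_w Z t w = \int[k s t x%:E]_y `|y|)%E.
  by move=> st x0; apply: (branching_mean bp st); rewrite /Sp /= lee_fin ltW.
have c12 : C1 -> C2 by move=> c1 t t0; apply: c1; rewrite ?lexx.
have c23 : C2 <-> C3.
  have zt t : 0 <= t -> 0 <= (0 : R) <= t by rewrite lexx.
  split=> H t t0; have := H t t0.
    by rewrite meanE ?zt//; move/(unit_mean_ltyP Hk lap (zt _ t0)).
  by rewrite meanE ?zt//; move/(unit_mean_ltyP Hk lap (zt _ t0)).
have c43 : C4 -> C3 by move=> c4 t t0; apply: c4; rewrite lexx.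
have c35 : C3 -> C5 by exact: evolution_herglotz.
have c54 : C5 -> C4 by move=> c5; exact: (herglotz_evolution Hv Hl Hh vq c5).
have c41 : C4 -> C1.
  move=> c4 s t x st x0; have [at0v dat0v] := c4 s t st.
  rewrite meanE// (mean_evolution lap)//.
  by rewrite lte_mul_pinfty// ?lee_fin ?(ltW x0).
(* A finite mean from time 0 and state 1 reaches all times and states by the detour (3), (5),
   (4). *)
have c21 : C2 -> C1 by move=> /c23 /c35 /c54 /c41.
split.
- by split.
- exact: c23.
- by split=> [/c35 /c54|/c43].
- by split=> [/c43 /c35|/c54].
split; first exact: (herglotz_levy_iff Hl).
move=> /c12 /c23 /c35 c5 s t x st x0.
have [at0v _] := c54 c5 s t st.
rewrite meanE// (mean_evolution lap)//; split=> //.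
by rewrite (dat0_evolution Hv Hl Hh vh v0 vq c5 st) EFinM.
Qed.
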